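(* Let $\Omega\subseteq\mathbb C^m$ be a bounded domain, $\boldsymbol T=(T_1,\dots,T_m)$ a commuting tuple in $B_n(\Omega^* )$, and $w\in\Omega^*$. Let $\boldsymbol\gamma=(\gamma_1,\dots,\gamma_n)$ be a holomorphic frame of $E_{\boldsymbol T}$ defined in a neighborhood of $w$ which is orthonormal at $w$, i.e. $h_{\boldsymbol\gamma}(w)=I_n$. Then there exists an orthonormal basis of the subspace $\mathcal M_w$ such that, for every $l=1,\dots,m$, the matrix of $N_l(w)$ with respect to this basis has the form $$N_l(w)=\begin{pmatrix}0_{n\times n} & \mathbf t_l(w)\\ 0_{mn\times n} & 0_{mn\times mn}\end{pmatrix},$$ where $\mathbf t_l(w)$ is an $n\times mn$ matrix, and the $mn\times mn$ matrix $\boldsymbol t(w)$ obtained by stacking $\mathbf t_1(w),\dots,\mathbf t_m(w)$ vertically satisfies $$\boldsymbol t(w)\,\overline{\boldsymbol t(w)}^{\rm tr}=-\big(\mathcal K_{\boldsymbol\gamma}(w)\big)^{-1}.$$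
   Context: $\Omega^*=\{\bar z: z\in\Omega\}$. A commuting $m$-tuple $\boldsymbol T=(T_1,\dots,T_m)$ of bounded operators on a complex separable Hilbert space $\mathcal H$ is in $B_n(\Omega^* )$ if: (1) $\dim\bigcap_{k=1}^m\ker(T_k-w_kI)=n$ for each $w\in\Omega^*$; (2) for each $w\in\Omega^*$ the operator $\mathcal H\to\mathcal H\oplus\cdots\oplus\mathcal H$ ($m$ summands), $h\mapsto\bigoplus_{k=1}^m(T_k-w_kI)h$, has closed range; (3) the closed linear span of $\bigcup_{w\in\Omega^*}\bigcap_{k=1}^m\ker(T_k-w_kI)$ is $\mathcal H$. $E_{\boldsymbol T}=\{(w,v)\in\Omega^*\times\mathcal H: v\in\bigcap_k\ker(T_k-w_k I)\}$ is the associated rank $n$ holomorphic Hermitian vector bundle over $\Omega^*$; a holomorphic frame near $w$ is a tuple $\boldsymbol\gamma=(\gamma_1,\dots,\gamma_n)$ of holomorphic $\mathcal H$-valued functions such that $\gamma_1(z),\dots,\gamma_n(z)$ is a basis of $\bigcap_k\ker(T_k-z_kI)$ for each $z$ near $w$. Put $h_{\boldsymbol\gamma}(z)=(\langle\gamma_j(z),\gamma_i(z)\rangle)_{i,j=1}^n$. $\mathcal M_w=\bigcap_{i,j=1}^m\ker\big((T_i-w_i)(T_j-w_j)\big)$ (which has dimension $(m+1)n$), and $N_l(w)=(T_l-w_l)|_{\mathcal M_w}$, $l=1,\dots,m$. With $\partial_i=\partial/\partial z_i$, $\bar\partial_i=\partial/\partial\bar z_i$, the curvature coefficients with respect to $\boldsymbol\gamma$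 are the $n\times n$ matrices $\mathcal K^{i,j}(\boldsymbol\gamma)(z)=-\bar\partial_j\big(h_{\boldsymbol\gamma}(z)^{-1}\partial_ih_{\boldsymbol\gamma}(z)\big)$. The curvature matrix $\mathcal K_{\boldsymbol\gamma}(w)$ is the $mn\times mn$ block matrix whose $(i,j)$ block ($1\le i,j\le m$) is $-\bar\partial_i\big(h_{\boldsymbol\gamma}^{-1}\partial_jh_{\boldsymbol\gamma}\big)(w)=\mathcal K^{j,i}(\boldsymbol\gamma)(w)$. *)

(* Defs.v *)
From HB Require Import structures.
From mathcomp Require Import all_boot all_order all_algebra.
From mathcomp Require Import complex.
From mathcomp Require Import all_classical all_reals all_analysis.

Set Implicit Arguments.
Unset Strict Implicit.
Unset Printing Implicit Defensive.

Import Order.TTheory GRing.Theory Num.Theory.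
Import numFieldTopology.Exports numFieldNormedType.Exports.

Local Open Scope classical_set_scope.
Local Open Scope complex_scope.
Local Open Scope ring_scope.

(* R[i] has field, order and norm structures in the library, but no topology
   is attached to it directly: it inherits the one every numFieldType has through R[i]^o. *)
#[export, non_forgetful_inheritance]
HB.instance Definition _ (R : realType) :=
  PseudoPointedMetric.copy R[i] (R[i])^o.

Section Domains.
Context {R : realType} {m : nat}.
Implicit Types A Omega : set 'rV[R[i]]_m.

Definition domain A := [/\ A !=set0, open A & connected A].

Definition conj_set Omega : set 'rV[R[i]]_m :=
  [set map_mx Num.conj z | z in Omega].

End Domains.

Section LinearAlgebra.
Context {R : realType} {H : lmodType R[i]}.

Definition lin_span (S : set H) : set H :=
  [set v | exists p (u : 'I_p -> H) (c : 'I_p -> R[i]),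
     (forall i, S (u i)) /\ v = \sum_(i < p) c i *: u i].

Definition is_basis p (e : 'I_p -> H) (V : set H) :=
  (forall c : 'I_p -> R[i], \sum_(i < p) c i *: e i = 0 -> forall i, c i = 0)
  /\ V = lin_span (range e).

Definition has_dim (V : set H) p := exists e : 'I_p -> H, is_basis e V.

Definition is_orthonormal_basis (dot : {dot H for Num.conj}) p
    (e : 'I_p -> H) (V : set H) :=
  is_basis e V /\ forall i j, dot (e i) (e j) = (i == j)%:R.

(* column q of A holds the coordinates of L (e q) *)
Definition is_matrix_of p (e : 'I_p -> H) (L : H -> H) (A : 'M[R[i]]_p) :=
  forall q, L (e q) = \sum_(k < p) A k q *: e k.

End LinearAlgebra.

Section CowenDouglas.
Context {R : realType} {H : completeNormedModType R[i]} {m : nat}.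
Variable T : 'I_m -> {linear H -> H}.
Implicit Types w z : 'rV[R[i]]_m.

Definition shift_op w k (v : H) : H := T k v - w 0 k *: v.

Definition joint_ker w : set H := [set v | forall k, shift_op w k v = 0].

(* The finite Hilbert sum of m copies of H carries the product topology, which
   is that of {ptws 'I_m -> H}. *)
Definition in_cowen_douglas n (D : set 'rV[R[i]]_m) :=
  [/\ forall w, D w -> has_dim (joint_ker w) n,
      forall w, D w ->
        closed (range (fun h => (shift_op w)^~ h : {ptws 'I_m -> H})) &
      closure (lin_span (\bigcup_(w in D) joint_ker w)) = setT].

Definition is_holomorphic_frame n (gamma : 'I_n -> 'rV[R[i]]_m -> H)
    (U : set 'rV[R[i]]_m) :=
  (forall j z, U z -> differentiable (gamma j) z) /\
  forall z, U z -> is_basis (gamma^~ z) (joint_ker z).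

(* The space M_w, on which N_k(w) is the restriction of shift_op w k. *)
Definition second_ker w : set H :=
  [set v | forall i j, shift_op w i (shift_op w j v) = 0].

End CowenDouglas.

(* 'D_v over the scalar field R[i] is the complex derivative, which does not
   exist for the non-holomorphic functions considered here: d/dz_k and
   d/dconj(z_k) are built from the real partial derivatives in x_k and y_k,
   i.e. along 'e_k and 'i *: 'e_k. *)
Section Wirtinger.
Context {R : realType} {m : nat}.
Implicit Types (g : 'rV[R[i]]_m -> R[i]) (z v : 'rV[R[i]]_m) (k : 'I_m).

(* derivative at t = 0, for t real, of t |-> g (z + t v) *)
Definition real_dir_deriv g z v : R[i] :=
  derive1 (fun t : R => complex.Re (g (z + t%:C *: v))) 0 +i*
  derive1 (fun t : R => complex.Im (g (z + t%:C *: v))) 0.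

Definition wirtinger k g z : R[i] :=
  2^-1 * (real_dir_deriv g z 'e_k - 'i * real_dir_deriv g z ('i *: 'e_k)).

Definition wirtinger_bar k g z : R[i] :=
  2^-1 * (real_dir_deriv g z 'e_k + 'i * real_dir_deriv g z ('i *: 'e_k)).

Definition wirtinger_mx k p q (G : 'rV[R[i]]_m -> 'M[R[i]]_(p, q)) z :=
  \matrix_(a, b) wirtinger k (fun x => G x a b) z.

Definition wirtinger_bar_mx k p q (G : 'rV[R[i]]_m -> 'M[R[i]]_(p, q)) z :=
  \matrix_(a, b) wirtinger_bar k (fun x => G x a b) z.

End Wirtinger.

Section Curvature.
Context {R : realType} {H : completeNormedModType R[i]} {m n : nat}.
Variables (dot : {dot H for Num.conj}) (gamma : 'I_n -> 'rV[R[i]]_m -> H).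

(* dot is linear in its first argument, conjugate-linear in its second. *)
Definition gram z : 'M[R[i]]_n := \matrix_(i, j) dot (gamma j z) (gamma i z).

Definition curvature_coef (i j : 'I_m) z : 'M[R[i]]_n :=
  - wirtinger_bar_mx j (fun x => invmx (gram x) *m wirtinger_mx i gram x) z.

(* \sum_(i < m) n, that is m * n, is the size \mxblock gives to an m x m block
   matrix with n x n blocks. *)
Definition curvature_mx z : 'M[R[i]]_(\sum_(i < m) n) :=
  \mxblock_(i < m, j < m) curvature_coef j i z.

End Curvature.

(* Main.v *)
Require Import Defs.
From HB Require Import structures.
From mathcomp Require Import all_boot all_order all_algebra.
From mathcomp Require Import complex.
From mathcomp Require Import all_classical all_reals all_analysis.
From mathcomp Require Import spectral ring lra.
Set Implicit Arguments.
Unset Strict Implicit.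
Unset Printing Implicit Defensive.
Import Order.TTheory GRing.Theory Num.Theory.
Import numFieldTopology.Exports numFieldNormedType.Exports.
Import Normc.
Local Open Scope classical_set_scope.
Local Open Scope complex_scope.
Local Open Scope ring_scope.

(* Differentiating (T_l - z_l) gamma_j(z) = 0 at w gives
   (T_l - w_l) d_k gamma_j = delta_kl gamma_j. Hence M_w is spanned by the
   gamma_j(w) and the components eta_kj of the d_k gamma_j(w) orthogonal to the
   joint kernel, and N_l(w) maps eta_kj to delta_kl gamma_j(w). If the Gram matrix
   of the eta_kj is factored as A^* A, orthonormalising them by A^-1 makes
   t(w) = A^-1. On the other hand, since h(w) = I,
     dbar_i (h^-1 d_j h) = <d_j gamma_b, d_i gamma_a>
                           - sum_c <gamma_c, d_i gamma_a> <d_j gamma_b, gamma_c>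
   at w, which says that - K(w) is the same Gram matrix A^* A.

   The curvature involves second derivatives, whereas the frame is only assumed to
   be complex differentiable at each point. For scalar functions they exist by
   Goursat's theorem and a third-order Taylor estimate with uniform constants on
   complex lines. For the frame it is enough that its first derivatives are locally
   bounded and that their inner products with fixed vectors are differentiable,
   which reduces to the scalar case. *)

(** * Integrals of complex functions along rectangles *)

Section ComplexModulus.
Context {R : realType}.
Implicit Types (z : R[i]) (x : R).

Lemma normrE z : `|z| = (normc z)%:C. Proof. by []. Qed.

Lemma addcE (a b c d : R) : (a +i* b) + (c +i* d) = (a + c) +i* (b + d).
Proof. by []. Qed.

Lemma mulcE (a b c d : R) :
  (a +i* b) * (c +i* d) = (a * c - b * d) +i* (a * d + b * c).
Proof. by []. Qed.

Lemma normc_ge0 z : 0 <= normc z.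
Proof. by case: z => a b; exact: sqrtr_ge0. Qed.

Lemma normc_real x : normc x%:C = `|x|.
Proof. by rewrite /= expr0n addr0 sqrtr_sqr. Qed.

Lemma normc_Re_le z : `|complex.Re z| <= normc z.
Proof. by rewrite -lecR; exact: normc_ge_Re. Qed.

Lemma normc_Im_le z : `|complex.Im z| <= normc z.
Proof.
by case: z => a b /=; rewrite -(sqrtr_sqr b) ler_wsqrtr// lerDr sqr_ge0.
Qed.

Lemma normcD_le z1 z2 : normc (z1 + z2) <= normc z1 + normc z2.
Proof. exact: le_normcD. Qed.

Lemma normcB_le z1 z2 : normc (z1 - z2) <= normc z1 + normc z2.
Proof. by rewrite -(normcN z2); exact: le_normcD. Qed.

Lemma normc_i : normc ('i : R[i]) = 1.
Proof. by rewrite /= expr0n add0r expr1n sqrtr1. Qed.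

Lemma normc_le_ReIm z : normc z <= `|complex.Re z| + `|complex.Im z|.
Proof.
rewrite {1}[z]complexE (le_trans (normcD_le _ _))// normcM normc_i mul1r.
by rewrite !normc_real.
Qed.

Lemma normcX z k : normc (z ^+ k) = normc z ^+ k.
Proof. by elim: k => [|k IH]; rewrite ?expr0 ?normc1// !exprS normcM IH. Qed.

Lemma normc_eq0 z : (normc z == 0) = (z == 0).
Proof. by apply/eqP/eqP => [/eq0_normc|->]//; rewrite normc0. Qed.

Lemma normc_gt0 z : (0 < normc z) = (z != 0).
Proof. by rewrite lt_neqAle normc_ge0 andbT eq_sym normc_eq0. Qed.

Lemma continuousC_dist (X : topologicalType) (g : X -> R[i]) (t : X) :
  {for t, continuous g} <->
  forall e : R, 0 < e -> \forall y \near t, normc (g t - g y) < e.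
Proof.
split=> [/(@cvgrPdist_lt _ R[i]^o) gt e e0|gt].
  have := gt e%:C; rewrite ltcR => /(_ e0); apply: filterS => y /=.
  by rewrite normrE ltcR.
apply/(@cvgrPdist_lt _ R[i]^o) => -[e e']; rewrite ltcE/= => /andP[/eqP-> e0].
by have := gt e e0; apply: filterS => y; rewrite normrE complexr0 ltcR.
Qed.

Lemma continuous_Re : continuous (@complex.Re R : R[i] -> R).
Proof.
move=> z; apply/(@cvgrPdist_lt R R _ (nbhs z)) => e e0.
have /continuousC_dist/(_ e e0) : {for z, continuous (@id R[i])} by exact: cvg_id.
apply: filterS => y; apply: le_lt_trans; rewrite -raddfB; exact: normc_Re_le.
Qed.

Lemma continuous_Im : continuous (@complex.Im R : R[i] -> R).
Proof.
move=> z; apply/(@cvgrPdist_lt R R _ (nbhs z)) => e e0.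
have /continuousC_dist/(_ e e0) : {for z, continuous (@id R[i])} by exact: cvg_id.
apply: filterS => y; apply: le_lt_trans; rewrite -raddfB; exact: normc_Im_le.
Qed.

End ComplexModulus.

Arguments normc : simpl never.

Section ComplexIntegral.
Context {R : realType}.
Notation mu := (@lebesgue_measure R).
Implicit Types (g h : R -> R[i]) (a b : R).

Definition cintegral g a b : R[i] :=
  (\int[mu]_(t in `[a, b]) complex.Re (g t)) +i*
  (\int[mu]_(t in `[a, b]) complex.Im (g t)).

Lemma cintegral_integrable g a b : {in `[a, b], continuous g} ->
  mu.-integrable `[a, b] (EFin \o (@complex.Re R \o g)) /\
  mu.-integrable `[a, b] (EFin \o (@complex.Im R \o g)).
Proof.
move=> cg.
have H (k : R[i] -> R) : continuous k ->
    mu.-integrable `[a, b] (EFin \o (k \o g)).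
  move=> ck; apply: continuous_compact_integrable; first exact: segment_compact.
  apply: continuous_in_subspaceT => t /set_mem /= tab.
  by apply: continuous_comp; [exact: cg|exact: ck].
by split; apply: H; [exact: continuous_Re|exact: continuous_Im].
Qed.

Lemma eq_cintegral g h a b : {in `[a, b], g =1 h} -> cintegral g a b = cintegral h a b.
Proof.
by move=> gh; congr (_ +i* _); apply: eq_Rintegral => t /set_mem tab;
  rewrite gh.
Qed.

Lemma cintegralD g h a b : {in `[a, b], continuous g} -> {in `[a, b], continuous h} ->
  cintegral (fun t => g t + h t) a b = cintegral g a b + cintegral h a b.
Proof.
move=> /cintegral_integrable[g1 g2] /cintegral_integrable[h1 h2].
rewrite /cintegral/=; apply/eqP; rewrite eq_complex/=.
by rewrite -!RintegralD//; apply/andP; split; apply/eqP;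
  apply: eq_Rintegral => t _; rewrite raddfD.
Qed.

Lemma cintegralZ (c : R[i]) g a b : {in `[a, b], continuous g} ->
  cintegral (fun t => c * g t) a b = c * cintegral g a b.
Proof.
move=> /cintegral_integrable[g1 g2].
have igZ (k : R) (u : R -> R) : mu.-integrable `[a, b] (EFin \o u) ->
    mu.-integrable `[a, b] (EFin \o (fun t => k * u t)).
  move=> iu; rewrite (_ : EFin \o _ = (fun t => k%:E * (EFin \o u) t)%E)//.
  exact: integrableZl.
case: c => c1 c2; rewrite /cintegral/=; apply/eqP; rewrite eq_complex/=.
rewrite -!RintegralZl//= -RintegralB//=; [|exact: igZ..].
rewrite -RintegralD//=; [|exact: igZ..].
by apply/andP; split; apply/eqP; apply: eq_Rintegral => t _; case: (g t).
Qed.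

Lemma cintegral_cst (c : R[i]) a b : a <= b -> cintegral (fun=> c) a b = (b - a)%:C * c.
Proof.
move=> ab; rewrite /cintegral !Rintegral_cst//= lebesgue_measure_itv/= lte_fin.
case: c => c1 c2; have [ab1|] := ltP a b; last first.
  by move=> ba; rewrite (@le_anti _ _ a b) ?ab// subrr !mulr0/= mul0r.
by rewrite /=; congr (_ +i* _); ring.
Qed.

Lemma cintegral_split g a b c : a <= c -> c <= b -> {in `[a, b], continuous g} ->
  cintegral g a b = cintegral g a c + cintegral g c b.
Proof.
move=> ac cb /cintegral_integrable[g1 g2].
have spl (u : R -> R) : mu.-integrable `[a, b] (EFin \o u) ->
    \int[mu]_(t in `[a, b]) u t =
    \int[mu]_(t in `[a, c]) u t + \int[mu]_(t in `[c, b]) u t.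
  move=> iu; have := Rintegral_itvB iu (x := c).
  rewrite !bnd_simp => /(_ ac cb) /eqP; rewrite subr_eq addrC => /eqP ->.
  congr (_ + _); rewrite Rintegral_itv_obnd_cbnd//.
  apply: integrableS iu => //; apply: subset_itvr; by rewrite bnd_simp.
by rewrite /cintegral/= (spl _ g1) (spl _ g2).
Qed.

Lemma cintegral_le g a b M : a <= b -> {in `[a, b], continuous g} ->
  (forall t, a <= t <= b -> normc (g t) <= M) ->
  normc (cintegral g a b) <= 2 * M * (b - a).
Proof.
move=> ab /cintegral_integrable[g1 g2] gM.
have bd (u : R -> R) : mu.-integrable `[a, b] (EFin \o u) ->
    (forall t, a <= t <= b -> `|u t| <= M) ->
    `|\int[mu]_(t in `[a, b]) u t| <= M * (b - a).
  move=> iu uM; apply: le_trans (le_normr_Rintegral _ iu) _ => //.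
  have -> : M * (b - a) = \int[mu]_(t in `[a, b]) cst M t.
    rewrite Rintegral_cst//= lebesgue_measure_itv/= lte_fin.
    have [ab1|ba] := ltP a b; first by [].
    by rewrite (@le_anti _ _ a b) ?ab// subrr mulr0.
  apply: le_Rintegral => //=.
  - exact: integrable_norm iu.
  - apply/continuous_compact_integrable; first exact: segment_compact.
    by apply: continuous_subspaceT => ?; exact: cvg_cst.
apply: le_trans (normc_le_ReIm _) _ => /=.
rewrite -mulrA mulr2n mulrDl mul1r lerD//; apply: bd => // t /gM; apply: le_trans.
- exact: normc_Re_le.
- exact: normc_Im_le.
Qed.

End ComplexIntegral.

Arguments cintegral : simpl never.

Section RectangleIntegral.
Context {R : realType}.
Implicit Types (f g : R[i] -> R[i]) (x y : R) (z : R[i]).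

Definition in_rect x0 x1 y0 y1 : set R[i] :=
  [set z | x0 <= complex.Re z <= x1 /\ y0 <= complex.Im z <= y1].

Definition frame x0 x1 y0 y1 : set R[i] :=
  [set z | in_rect x0 x1 y0 y1 z /\
    [\/ complex.Re z = x0, complex.Re z = x1,
        complex.Im z = y0 | complex.Im z = y1]].

Lemma frame_in_rect x0 x1 y0 y1 : frame x0 x1 y0 y1 `<=` in_rect x0 x1 y0 y1.
Proof. by move=> z []. Qed.

Definition rect_int f x0 x1 y0 y1 : R[i] :=
  cintegral (fun x => f (x +i* y0)) x0 x1 - cintegral (fun x => f (x +i* y1)) x0 x1 +
  'i%C * (cintegral (fun y => f (x1 +i* y)) y0 y1 - cintegral (fun y => f (x0 +i* y)) y0 y1).

Lemma continuous_horizontal f x y :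
  {for (x +i* y), continuous f} -> {for x, continuous (fun t => f (t +i* y))}.
Proof.
move=> cf; suff h : {for x, continuous (fun t => t +i* y)}.
  exact: (@cvg_comp _ _ _ _ f _ _ _ h cf).
apply/continuousC_dist => e e0; near=> t.
rewrite [_ - _](_ : _ = (x - t)%:C); last by rewrite -complexr0; simpc.
by rewrite normc_real; near: t; apply: cvgr_dist_lt.
Unshelve. all: by end_near. Qed.

Lemma continuous_vertical f x y :
  {for (x +i* y), continuous f} -> {for y, continuous (fun t => f (x +i* t))}.
Proof.
move=> cf; suff h : {for y, continuous (fun t => x +i* t)}.
  exact: (@cvg_comp _ _ _ _ f _ _ _ h cf).
apply/continuousC_dist => e e0; near=> t.
rewrite [_ - _](_ : _ = 'i%C * (y - t)%:C); last by rewrite -complexr0; simpc.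
by rewrite normcM normc_i mul1r normc_real; near: t; apply: cvgr_dist_lt.
Unshelve. all: by end_near. Qed.

Section Sides.
Variables x0 x1 y0 y1 : R.
Hypotheses (x01 : x0 <= x1) (y01 : y0 <= y1).
Local Notation F := (frame x0 x1 y0 y1).
Local Notation I f := (rect_int f x0 x1 y0 y1).

Lemma frame_bottom x : x0 <= x <= x1 -> F (x +i* y0).
Proof. by move=> xx; split; [rewrite /in_rect /= xx lexx|apply: Or43]. Qed.

Lemma frame_top x : x0 <= x <= x1 -> F (x +i* y1).
Proof. by move=> xx; split; [rewrite /in_rect /= xx lexx andbT|apply: Or44]. Qed.

Lemma frame_left y : y0 <= y <= y1 -> F (x0 +i* y).
Proof. by move=> yy; split; [rewrite /in_rect /= yy lexx|apply: Or41]. Qed.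

Lemma frame_right y : y0 <= y <= y1 -> F (x1 +i* y).
Proof. by move=> yy; split; [rewrite /in_rect /= yy lexx andbT|apply: Or42]. Qed.

Lemma side_continuous f : (forall z, F z -> {for z, continuous f}) ->
  [/\ {in `[x0, x1], continuous (fun x => f (x +i* y0))},
      {in `[x0, x1], continuous (fun x => f (x +i* y1))},
      {in `[y0, y1], continuous (fun y => f (x0 +i* y))} &
      {in `[y0, y1], continuous (fun y => f (x1 +i* y))}].
Proof.
move=> cf; split=> t; rewrite in_itv/= => tt.
- by apply: continuous_horizontal; apply: cf; exact: frame_bottom.
- by apply: continuous_horizontal; apply: cf; exact: frame_top.
- by apply: continuous_vertical; apply: cf; exact: frame_left.
- by apply: continuous_vertical; apply: cf; exact: frame_right.
Qed.

Lemma eq_rect_int f g : {in F, f =1 g} -> I f = I g.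
Proof.
move=> fg; rewrite /rect_int; do ![congr (_ + _)|congr (_ * _)|congr (- _)];
  apply: eq_cintegral => t; rewrite in_itv/= => tt; apply: fg; apply/mem_set.
- exact: frame_bottom.
- exact: frame_top.
- exact: frame_right.
- exact: frame_left.
Qed.

Lemma rect_intD f g : (forall z, F z -> {for z, continuous f}) ->
  (forall z, F z -> {for z, continuous g}) ->
  I (fun z => f z + g z) = I f + I g.
Proof.
move=> /side_continuous[f1 f2 f3 f4] /side_continuous[g1 g2 g3 g4].
by rewrite /rect_int !cintegralD//; ring.
Qed.

Lemma rect_intZ c f : (forall z, F z -> {for z, continuous f}) ->
  I (fun z => c * f z) = c * I f.
Proof.
by move=> /side_continuous[f1 f2 f3 f4]; rewrite /rect_int !cintegralZ//; ring.
Qed.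

Lemma rect_int_le f M : (forall z, F z -> {for z, continuous f}) ->
  (forall z, F z -> normc (f z) <= M) ->
  normc (I f) <= 4 * M * ((x1 - x0) + (y1 - y0)).
Proof.
move=> /side_continuous[f1 f2 f3 f4] fM; rewrite /rect_int.
apply: le_trans (normcD_le _ _) _; rewrite normcM normc_i mul1r.
have -> : 4 * M * (x1 - x0 + (y1 - y0)) =
  (2 * M * (x1 - x0) + 2 * M * (x1 - x0)) +
  (2 * M * (y1 - y0) + 2 * M * (y1 - y0)) by ring.
apply: lerD; apply: le_trans (normcB_le _ _) _; apply: lerD;
  apply: cintegral_le => // t tt; apply: fM.
- exact: frame_bottom.
- exact: frame_top.
- exact: frame_right.
- exact: frame_left.
Qed.

Lemma rect_int_splitx f x : x0 <= x <= x1 ->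
  (forall z, F z -> {for z, continuous f}) ->
  I f = rect_int f x0 x y0 y1 + rect_int f x x1 y0 y1.
Proof.
move=> /andP[x0x xx1] /side_continuous[f1 f2 f3 f4].
by rewrite /rect_int (cintegral_split x0x xx1 f1) (cintegral_split x0x xx1 f2); ring.
Qed.

Lemma rect_int_splity f y : y0 <= y <= y1 ->
  (forall z, F z -> {for z, continuous f}) ->
  I f = rect_int f x0 x1 y0 y + rect_int f x0 x1 y y1.
Proof.
move=> /andP[y0y yy1] /side_continuous[f1 f2 f3 f4].
by rewrite /rect_int (cintegral_split y0y yy1 f3) (cintegral_split y0y yy1 f4); ring.
Qed.

End Sides.

Lemma near_normc z (e : R) : 0 < e -> \forall u \near z, normc (z - u) < e.
Proof.
move=> e0; have [H _] := @continuousC_dist R _ (@id R[i]) z.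
by apply: H => //; exact: cvg_id.
Qed.

Lemma continuous_affine (c l z : R[i]) :
  {for z, continuous (fun u => c + l * u : R[i])}.
Proof.
apply/continuousC_dist => e e0.
have l1 : 0 < normc l + 1 by rewrite ltr_wpDl// normc_ge0.
near=> u.
rewrite [_ - _](_ : _ = l * (z - u)); last by ring.
rewrite normcM.
apply: (@le_lt_trans _ _ ((normc l + 1) * normc (z - u))).
  by rewrite ler_wpM2r ?normc_ge0// lerDl.
rewrite mulrC -ltr_pdivlMr//; near: u.
by apply: near_normc; exact: divr_gt0.
Unshelve. all: by end_near. Qed.

Lemma rect_int_affine (c l : R[i]) x0 x1 y0 y1 : x0 <= x1 -> y0 <= y1 ->
  rect_int (fun z => c + l * z) x0 x1 y0 y1 = 0.
Proof.
move=> x01 y01.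
have [f1 f2 f3 f4] := @side_continuous _ _ _ _ x01 y01 _
  (fun z _ => @continuous_affine c l z).
have sub a b (u v : R -> R[i]) (k : R[i]) : a <= b ->
    {in `[a, b], continuous v} -> (forall t, u t = k + v t) ->
    cintegral u a b - cintegral v a b = (b - a)%:C * k.
  move=> ab cv uv; rewrite (@eq_cintegral _ u (fun t => k + v t)); last by move=> t _.
  rewrite (@cintegralD _ (fun=> k) v a b _ cv); last first.
    by move=> t _; apply/continuousC_dist => e e0; near=> s; rewrite subrr normc0.
  by rewrite cintegral_cst// addrK.
rewrite /rect_int.
have -> : cintegral (fun x => c + l * (x +i* y0)) x0 x1 -
    cintegral (fun x => c + l * (x +i* y1)) x0 x1 =
    (x1 - x0)%:C * (l * (0 +i* (y0 - y1))).
  apply: sub; [exact: x01|exact: f2|move=> t].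
  have -> : t +i* y0 = (0 +i* (y0 - y1)) + (t +i* y1).
    by rewrite addcE; congr (_ +i* _); ring.
  ring.
have -> : cintegral (fun y => c + l * (x1 +i* y)) y0 y1 -
    cintegral (fun y => c + l * (x0 +i* y)) y0 y1 =
    (y1 - y0)%:C * (l * ((x1 - x0) +i* 0)).
  apply: sub; [exact: y01|exact: f3|move=> t].
  have -> : x1 +i* t = ((x1 - x0) +i* 0) + (x0 +i* t).
    by rewrite addcE; congr (_ +i* _); ring.
  ring.
case: l {f1 f2 f3 f4 sub} => l1 l2.
by rewrite !(mulcE, addcE); congr (_ +i* _); ring.
Unshelve. all: by end_near. Qed.

End RectangleIntegral.

Arguments rect_int : simpl never.

(** * Goursat's theorem *)

Lemma derivable_dist (K : numFieldType) (V : normedModType K) (f : K -> V)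
    (z : K) : derivable f z 1 ->
  exists l, forall e : K, 0 < e -> exists2 d : K, 0 < d &
    forall u, `|u - z| < d -> `|f u - (f z + (u - z) *: l)| <= e * `|u - z|.
Proof.
move=> /cvgrPdist_le df; exists ('D_1 f z) => e /df.
rewrite /dnbhs/= /within/= => /nbhs_normP[d /= d0 H]; exists d => // u uz.
have [->|u0] := eqVneq u z; first by rewrite subrr scale0r addr0 subrr !normr0 mulr0.
have := H (u - z); rewrite /ball_/= sub0r normrN => /(_ uz); rewrite subr_eq0 => /(_ u0).
rewrite scaler1 subrK -(ler_pM2l (_ : 0 < `|u - z|)) ?normr_gt0 ?subr_eq0//.
rewrite -normrZ -normrN scalerBr scalerA divff ?subr_eq0// scale1r opprB.
by rewrite opprD addrA mulrC.
Qed.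

Lemma nested_segments (R : realType) (u L : nat -> R) :
  (forall k, u k <= u k.+1) -> (forall k, u k.+1 + L k.+1 <= u k + L k) ->
  (forall k, 0 <= L k) -> exists p, forall k, u k <= p <= u k + L k.
Proof.
move=> u1 uL L0.
have mono j k : (j <= k)%N -> u j <= u k /\ u k + L k <= u j + L j.
  elim: k => [|k IH]; first by rewrite leqn0 => /eqP ->.
  rewrite leq_eqVlt => /orP[/eqP->//|]; rewrite ltnS => /IH[h1 h2].
  by split; [exact: le_trans (u1 k)|exact: le_trans (uL k) _].
have ub k : ubound (range u) (u k + L k).
  move=> _ [j _ <-]; case: (leqP j k) => [/mono[h _]|/ltnW/mono[_ h]].
    by apply: le_trans h _; rewrite lerDl.
  by apply: le_trans h; rewrite lerDl.
have hs : has_sup (range u).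
  by split; [exists (u 0%N), 0%N|exists (u 0%N + L 0%N); exact: ub].
exists (sup (range u)) => k; apply/andP; split.
  by apply: ub_le_sup; [case: hs|exists k].
by apply: ge_sup; [case: hs|exact: ub].
Qed.

Lemma exp2_unbounded (R : realType) (x : R) : exists k, x < 2 ^+ k.
Proof.
exists (Num.bound `|x|); apply: le_lt_trans (ler_norm x) _.
apply: lt_trans (archi_boundP (normr_ge0 x)) _.
by rewrite -natrX ltr_nat; exact: ltn_expl.
Qed.

Lemma quarter_ge (R : realFieldType) (c q a b d e : R) :
  c <= q * (a + b + (d + e)) ->
  [\/ c <= 4 * q * a, c <= 4 * q * b, c <= 4 * q * d | c <= 4 * q * e].
Proof.
move=> h; have [h1|h1] := leP c (4 * q * a); first exact: Or41.
have [h2|h2] := leP c (4 * q * b); first exact: Or42.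
have [h3|h3] := leP c (4 * q * d); first exact: Or43.
have [h4|h4] := leP c (4 * q * e); first exact: Or44.
lra.
Qed.

Lemma dist_le_segment (R : realFieldType) (x a p q : R) :
  x <= p <= x + a -> x <= q <= x + a -> `|p - q| <= a.
Proof.
move=> /andP[p1 p2] /andP[q1 q2].
by rewrite ler_norml; apply/andP; split; lra.
Qed.

Section Goursat.
Context {R : realType}.
Local Notation C := (R[i]^o).
Implicit Types (f : R[i] -> R[i]) (z : R[i]) (x y : R).

Lemma derivableC_dist f z : derivable (f : C -> C) z 1 ->
  exists l, forall e : R, 0 < e -> exists2 d : R, 0 < d &
    forall u, normc (u - z) < d ->
      normc (f u - (f z + l * (u - z))) <= e * normc (u - z).
Proof.
move=> /(@derivable_dist R[i] R[i]^o f z)[l H]; exists l => e e0.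
have [|d] := H e%:C; first by rewrite ltcR.
case: d => d d'; rewrite ltcE/= => /andP[/eqP-> d0] h; exists d => // u uz.
have : (normc (u - z))%:C < d%:C ->
    (normc (f u - (f z + (u - z) * l)))%:C <= e%:C * (normc (u - z))%:C := h u.
rewrite ltcR => /(_ uz).
by rewrite -rmorphM lecR mulrC.
Qed.

Lemma derivableC_continuous f z : derivable (f : C -> C) z 1 ->
  {for z, continuous f}.
Proof. by move=> /derivable1_diffP/differentiable_continuous. Qed.

Lemma continuousC_add (X : topologicalType) (f g : X -> R[i]) (t : X) :
  {for t, continuous f} -> {for t, continuous g} ->
  {for t, continuous (fun u => f u + g u)}.
Proof. by move=> cf cg; exact: (@cvgD R[i] R[i]^o X (nbhs t) _ f g _ _ cf cg). Qed.

Section Quadrants.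
Variables (f : R[i] -> R[i]) (x0 x1 y0 y1 : R).
Hypotheses (x01 : x0 <= x1) (y01 : y0 <= y1).
Hypothesis df : forall z, in_rect x0 x1 y0 y1 z -> derivable (f : C -> C) z 1.

Let A := x1 - x0.
Let B := y1 - y0.
Let inside k (p : R * R) :=
  (x0 <= p.1 /\ p.1 + A / 2 ^+ k <= x1) /\ (y0 <= p.2 /\ p.2 + B / 2 ^+ k <= y1).
Let part k (p : R * R) := rect_int f p.1 (p.1 + A / 2 ^+ k) p.2 (p.2 + B / 2 ^+ k).
Let c := normc (rect_int f x0 x1 y0 y1).
Let bad k p := inside k p /\ c <= 4 ^+ k * normc (part k p).

Lemma halving_ge0 k : 0 <= A / 2 ^+ k /\ 0 <= B / 2 ^+ k.
Proof. by split; rewrite divr_ge0 ?exprn_ge0// subr_ge0. Qed.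

Lemma halvingE (x : R) k : x / 2 ^+ k = x / 2 ^+ k.+1 + x / 2 ^+ k.+1.
Proof. by rewrite exprS; field; rewrite expf_neq0. Qed.

Lemma quadrant_step k p : bad k p -> exists q, [/\ bad k.+1 q,
  p.1 <= q.1 /\ q.1 + A / 2 ^+ k.+1 <= p.1 + A / 2 ^+ k &
  p.2 <= q.2 /\ q.2 + B / 2 ^+ k.+1 <= p.2 + B / 2 ^+ k].
Proof.
case: p => x y [[/= [hx0 hx1] [hy0 hy1]]].
rewrite /part/= !(halvingE _ k) in hx1 hy1 *.
have [a0 b0] := halving_ge0 k.+1.
set a := A / 2 ^+ k.+1 in a0 hx1 *; set b := B / 2 ^+ k.+1 in b0 hy1 *.
have cf u0 u1 v0 v1 : x0 <= u0 -> u1 <= x1 -> y0 <= v0 -> v1 <= y1 ->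
    forall z, frame u0 u1 v0 v1 z -> {for z, continuous f}.
  move=> h1 h2 h3 h4 z [[/andP[z1 z2] /andP[z3 z4]] _].
  apply: derivableC_continuous; apply: df; split.
    by rewrite (le_trans h1 z1) (le_trans z2 h2).
  by rewrite (le_trans h3 z3) (le_trans z4 h4).
have -> : rect_int f x (x + (a + a)) y (y + (b + b)) =
    (rect_int f x (x + a) y (y + b) + rect_int f x (x + a) (y + b) (y + b + b)) +
    (rect_int f (x + a) (x + a + a) y (y + b) +
     rect_int f (x + a) (x + a + a) (y + b) (y + b + b)).
  rewrite (@rect_int_splitx _ x (x + (a + a)) y (y + (b + b)) _ _ _ (x + a));
    [|lra|lra|apply/andP; split; lra|by apply: cf; lra].
  congr (_ + _).
    rewrite (@rect_int_splity _ x (x + a) y (y + (b + b)) _ _ _ (y + b));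
      [|lra|lra|apply/andP; split; lra|by apply: cf; lra].
    by rewrite (addrA y).
  rewrite (addrA x) (@rect_int_splity _ (x + a) (x + a + a) y (y + (b + b)) _ _ _ (y + b));
    [|lra|lra|apply/andP; split; lra|by apply: cf; lra].
  by rewrite (addrA y).
set r1 := rect_int f x _ y _; set r2 := rect_int f x _ _ _.
set r3 := rect_int f _ _ y _; set r4 := rect_int f _ _ _ _ => hc.
have {}hc : c <= 4 ^+ k * (normc r1 + normc r2 + (normc r3 + normc r4)).
  apply: le_trans hc _; rewrite ler_wpM2l ?exprn_ge0//.
  apply: le_trans (normcD_le _ _) _; apply: lerD; exact: normcD_le.
pose ok q := c <= 4 ^+ k.+1 * normc (part k.+1 q).
have goodq (q : R * R) : (q.1 = x \/ q.1 = x + a) -> (q.2 = y \/ q.2 = y + b) ->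
    ok q -> exists q, [/\ bad k.+1 q,
      x <= q.1 /\ q.1 + a <= x + (a + a) & y <= q.2 /\ q.2 + b <= y + (b + b)].
  move=> q1 q2 okq.
  have [xq xq'] : x <= q.1 /\ q.1 + a <= x + (a + a).
    by case: q1 => ->; rewrite (addrA x) ?lexx lerDl a0.
  have [yq yq'] : y <= q.2 /\ q.2 + b <= y + (b + b).
    by case: q2 => ->; rewrite (addrA y) ?lexx lerDl b0.
  exists q; split=> //; split=> //; rewrite /inside -/a -/b.
  by split; split; [exact: le_trans xq|exact: le_trans hx1
                   |exact: le_trans yq|exact: le_trans hy1].
move: hc => /quarter_ge; rewrite -exprS => -[] h.
- by apply: (goodq (x, y)) h; left.
- by apply: (goodq (x, y + b)) h; [left|right].
- by apply: (goodq (x + a, y)) h; [right|left].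
- by apply: (goodq (x + a, y + b)) h; right.
Qed.

(* Some quarter always keeps a quarter of the integral. At the limit point of
   the nested quarters, the affine part of [f] contributes nothing and the rest
   is negligible with respect to the area. *)
Lemma rect_int_derivable_eq0 : rect_int f x0 x1 y0 y1 = 0.
Proof.
apply/eqP; rewrite -normc_eq0 -/c; apply/negP => /negP c_neq0.
have c0 : 0 < c by rewrite lt_neqAle eq_sym c_neq0 normc_ge0.
pose next (kp : nat * (R * R)) (q : R * R) := bad kp.1 kp.2 ->
    [/\ bad kp.1.+1 q,
    kp.2.1 <= q.1 /\ q.1 + A / 2 ^+ kp.1.+1 <= kp.2.1 + A / 2 ^+ kp.1 &
    kp.2.2 <= q.2 /\ q.2 + B / 2 ^+ kp.1.+1 <= kp.2.2 + B / 2 ^+ kp.1].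
have [F FP] : {F : nat * (R * R) -> R * R & forall kp, next kp (F kp)}.
  apply: choice => -[k p]; rewrite /next /=.
  have [/quadrant_step[q qP]|nb] := pselect (bad k p); first by exists q.
  by exists p.
pose u := fix u k := if k is k'.+1 then F (k', u k') else (x0, y0).
have ubad k : bad k (u k).
  elim: k => [|k IH]; last by have [] := FP (k, u k) IH.
  rewrite /bad /inside /part /= !expr0 !divr1 mul1r /A /B !subrKC.
  by rewrite -/c; split=> //; split; split.
have [px pxP] : exists p, forall k, (u k).1 <= p <= (u k).1 + A / 2 ^+ k.
  apply: nested_segments => k; last by have [] := halving_ge0 k.
  - by have [_ []] := FP (k, u k) (ubad k).
  - by have [_ []] := FP (k, u k) (ubad k).
have [py pyP] : exists p, forall k, (u k).2 <= p <= (u k).2 + B / 2 ^+ k.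
  apply: nested_segments => k; last by have [] := halving_ge0 k.
  - by have [_ _ []] := FP (k, u k) (ubad k).
  - by have [_ _ []] := FP (k, u k) (ubad k).
pose p := px +i* py; pose D := A + B.
have D0 : 0 <= D by rewrite addr_ge0// subr_ge0.
have pin : in_rect x0 x1 y0 y1 p.
  move: (pxP 0%N) (pyP 0%N) => /=; rewrite expr0 !divr1 /A /B !subrKC.
  by move=> h1 h2; split.
have [l Hl] := derivableC_dist (df pin).
have E0 : 0 < 4 * D ^+ 2 + 1 by rewrite ltr_wpDl// mulr_ge0// sqr_ge0.
have [d d0 Hd] := Hl (c / (4 * D ^+ 2 + 1)) (divr_gt0 c0 E0).
have [k kP] := exp2_unbounded (D / d).
have k0 : 0 < 2 ^+ k :> R by rewrite exprn_gt0.
have Dk : D / 2 ^+ k < d by rewrite ltr_pdivrMr// mulrC -ltr_pdivrMr.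
have [[[i1 i2] [i3 i4]] hbad] := ubad k.
have [a0 b0] := halving_ge0 k.
move: (pxP k) (pyP k) hbad i1 i2 i3 i4; rewrite /part.
case: (u k) => x y /=; set a := A / 2 ^+ k in a0 *; set b := B / 2 ^+ k in b0 *.
move=> /andP[px1 px2] /andP[py1 py2] hbad i1 i2 i3 i4.
have xa : x <= x + a by rewrite lerDl.
have yb : y <= y + b by rewrite lerDl.
have cf z : frame x (x + a) y (y + b) z -> {for z, continuous f}.
  move=> [[/andP[z1 z2] /andP[z3 z4]] _].
  apply: derivableC_continuous; apply: df; split.
    by rewrite (le_trans i1 z1) (le_trans z2 i2).
  by rewrite (le_trans i3 z3) (le_trans z4 i4).
have ca z := @continuous_affine R (l * p - f p) (- l) z.
have rE : rect_int f x (x + a) y (y + b) =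
    rect_int (fun z => f z + (l * p - f p + - l * z)) x (x + a) y (y + b).
  by rewrite (rect_intD xa yb cf (fun z _ => ca z)) (rect_int_affine _ _ xa yb) addr0.
have abD : a + b = D / 2 ^+ k by rewrite /D mulrDl.
have : normc (rect_int f x (x + a) y (y + b)) <=
    4 * (c / (4 * D ^+ 2 + 1) * (D / 2 ^+ k)) * (D / 2 ^+ k).
  rewrite rE -{2}abD; set M := c / (4 * D ^+ 2 + 1) * (D / 2 ^+ k).
  apply: le_trans (rect_int_le xa yb (M := M) _ _) _.
  - by move=> z zF; apply: continuousC_add; [exact: cf|exact: ca].
  - move=> z [[/andP[z1 z2] /andP[z3 z4]] _].
    have zp : normc (z - p) <= D / 2 ^+ k.
      apply: le_trans (normc_le_ReIm _) _; rewrite !raddfB/= -abD.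
      apply: lerD.
        by apply: (@dist_le_segment _ x); [rewrite z1 z2|rewrite px1 px2].
      by apply: (@dist_le_segment _ y); [rewrite z3 z4|rewrite py1 py2].
    rewrite (_ : f z + _ = f z - (f p + l * (z - p))); last by ring.
    apply: le_trans (Hd z (le_lt_trans zp Dk)) _.
    by rewrite ler_wpM2l// divr_ge0// ltW.
  - by rewrite [x + a]addrC [y + b]addrC !addrK.
have k4 : 0 <= 4 ^+ k :> R by rewrite exprn_ge0.
move=> /(ler_wpM2l k4) /(le_trans hbad).
have -> : 4 ^+ k * (4 * (c / (4 * D ^+ 2 + 1) * (D / 2 ^+ k)) * (D / 2 ^+ k)) =
   c * (4 * D ^+ 2 / (4 * D ^+ 2 + 1)).
  rewrite (_ : 4 ^+ k = 2 ^+ k * 2 ^+ k :> R); last by rewrite -exprMn; congr (_ ^+ _); ring.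
  by field; rewrite !gt_eqF.
rewrite -{1}(mulr1 c) ler_pM2l// ler_pdivlMr// mul1r; lra.
Qed.

End Quadrants.

End Goursat.

Section PuncturedGoursat.
Context {R : realType}.
Local Notation C := (R[i]^o).
Implicit Types (f : R[i] -> R[i]) (z : R[i]) (x y : R).

Lemma rect_int_shrink f x0 x1 y0 y1 u0 u1 v0 v1 :
  x0 <= u0 -> u0 <= u1 -> u1 <= x1 -> y0 <= v0 -> v0 <= v1 -> v1 <= y1 ->
  (forall z, in_rect x0 x1 y0 y1 z ->
     ~~ ((u0 < complex.Re z < u1) && (v0 < complex.Im z < v1)) ->
     derivable (f : C -> C) z 1) ->
  rect_int f x0 x1 y0 y1 = rect_int f u0 u1 v0 v1.
Proof.
move=> xu uu ux yv vv vy df.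
have cF a b c d : x0 <= a -> a <= u0 -> u1 <= b -> b <= x1 ->
    y0 <= c -> c <= v0 -> v1 <= d -> d <= y1 ->
    forall z, frame a b c d z -> {for z, continuous f}.
  move=> h1 h2 h3 h4 h5 h6 h7 h8 z [[/andP[z1 z2] /andP[z3 z4]] zF].
  apply: derivableC_continuous; apply: df.
    split; first by rewrite (le_trans h1 z1) (le_trans z2 h4).
    by rewrite (le_trans h5 z3) (le_trans z4 h8).
  rewrite negb_and !negb_and -!leNgt.
  by case: zF => ->; rewrite ?h2 ?h3 ?h6 ?h7 ?orbT.
have r0 a b c d : x0 <= a -> a <= b -> b <= x1 ->
    y0 <= c -> c <= d -> d <= y1 ->
    [|| b <= u0, u1 <= a, d <= v0 | v1 <= c] -> rect_int f a b c d = 0.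
  move=> h1 h2 h3 h4 h5 h6 h7; apply: rect_int_derivable_eq0; [exact: h2|exact: h5|].
  move=> z [/andP[z1 z2] /andP[z3 z4]]; apply: df.
    split; first by rewrite (le_trans h1 z1) (le_trans z2 h3).
    by rewrite (le_trans h4 z3) (le_trans z4 h6).
  rewrite negb_and !negb_and -!leNgt.
  case/or4P: h7 => h.
  - by rewrite (le_trans z2 h).
  - by rewrite (le_trans h z1) orbT.
  - by rewrite (le_trans z4 h) !orbT.
  - by rewrite (le_trans h z3) !orbT.
have ux0 := le_trans xu uu; have vy0 := le_trans yv vv.
have ux1 := le_trans uu ux; have vy1 := le_trans vv vy.
have y01 := le_trans yv vy1.
rewrite (@rect_int_splitx _ x0 x1 y0 y1 (le_trans xu ux1) y01 _ u0); first last.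
- by apply: cF.
- by rewrite xu.
rewrite (r0 x0 u0) ?lexx// add0r.
rewrite (@rect_int_splitx _ u0 x1 y0 y1 ux1 y01 _ u1); first last.
- by apply: cF.
- by rewrite uu.
rewrite (r0 u1 x1) ?lexx ?orbT// addr0.
rewrite (@rect_int_splity _ u0 u1 y0 y1 uu y01 _ v0); first last.
- by apply: cF.
- by rewrite yv.
rewrite (r0 u0 u1 y0 v0) ?lexx ?orbT// add0r.
rewrite (@rect_int_splity _ u0 u1 v0 y1 uu vy1 _ v1); first last.
- by apply: cF.
- by rewrite vv.
by rewrite (r0 u0 u1 v1 y1) ?lexx ?orbT// addr0.
Qed.

(* Nothing is asked of [f p]: this is applied to a difference quotient based at
   [p], whose value there is the junk [0 / 0]. *)
Lemma rect_int_punctured_eq0 f x0 x1 y0 y1 p :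
  x0 < complex.Re p < x1 -> y0 < complex.Im p < y1 ->
  (forall z, in_rect x0 x1 y0 y1 z -> z != p -> derivable (f : C -> C) z 1) ->
  (exists M, exists2 d, 0 < d & forall z, z != p -> normc (z - p) < d ->
     normc (f z) <= M) ->
  rect_int f x0 x1 y0 y1 = 0.
Proof.
case: p => px py /= /andP[px0 px1] /andP[py0 py1] df [M0 [d d0 Hd]].
apply/eqP; rewrite -normc_eq0; apply/negP => /negP c_neq0.
set c := normc _ in c_neq0.
have c0 : 0 < c by rewrite lt_neqAle eq_sym c_neq0 normc_ge0.
pose M := `|M0| + 1.
have M_gt0 : 0 < M by rewrite ltr_wpDl.
pose e := Num.min (Num.min (Num.min (px - x0) (x1 - px)) (Num.min (py - y0) (y1 - py)))
              (Num.min (d / 3) (c / (32 * M))).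
have e0 : 0 < e.
  by rewrite !lt_min !subr_gt0 px0 px1 py0 py1 !divr_gt0// mulr_gt0.
have [e1 e2 e3 e4] : [/\ e <= px - x0, e <= x1 - px, e <= py - y0 & e <= y1 - py].
  by split; rewrite !ge_min lexx ?orbT.
have [e5 e6] : e <= d / 3 /\ e <= c / (32 * M).
  by split; rewrite !ge_min lexx ?orbT.
have ee : e + e < d by apply: (@le_lt_trans _ _ (d / 3 + d / 3)); [exact: lerD|lra].
have eM : 4 * M * (e + e + (e + e)) < c.
  have : e * (32 * M) <= c by rewrite -ler_pdivlMr// mulr_gt0.
  by apply: lt_le_trans; rewrite -subr_gt0 (_ : _ - _ = 16 * (e * M)) ?mulr_gt0//; ring.
have [xl xr yl yr] : [/\ x0 <= px - e, px + e <= x1, y0 <= py - e & py + e <= y1].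
  by split; rewrite ?lerBrDr -lerBrDl.
have xe : px - e <= px + e by rewrite lerD2l (le_trans _ (ltW e0))// oppr_le0 ltW.
have ye : py - e <= py + e by rewrite lerD2l (le_trans _ (ltW e0))// oppr_le0 ltW.
have cE : rect_int f x0 x1 y0 y1 = rect_int f (px - e) (px + e) (py - e) (py + e).
  apply: rect_int_shrink xl xe xr yl ye yr _ => z zin zout; apply: df => //.
  by apply: contraNneq zout => ->; rewrite /= !ltrBlDr !ltrDl e0.
have nez z : frame (px - e) (px + e) (py - e) (py + e) z -> z != px +i* py.
  move=> [_ zF]; apply/eqP => zp; move: zF; rewrite zp /=.
  by case=> /eqP; rewrite ?[_ == _ - e]gt_eqF ?gtrBl// [_ == _ + e]lt_eqF ?ltrDl.
have : c <= 4 * M * (px + e - (px - e) + (py + e - (py - e))).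
  rewrite /c cE; apply: (rect_int_le xe ye) => z zF; have [/= zx zy] := frame_in_rect zF.
    apply: derivableC_continuous; apply: df (nez z zF).
    move: zx zy => /andP[z1 z2] /andP[z3 z4]; split.
      by rewrite (le_trans xl z1) (le_trans z2 xr).
    by rewrite (le_trans yl z3) (le_trans z4 yr).
  apply: (@le_trans _ _ M0); last first.
    by apply: (le_trans (ler_norm _)); rewrite /M lerDl.
  apply: Hd (nez z zF) _.
  apply: le_lt_trans (normc_le_ReIm _) _; rewrite !raddfB /=.
  have h1 : `|complex.Re z - px| <= e by rewrite ler_distl.
  have h2 : `|complex.Im z - py| <= e by rewrite ler_distl.
  exact: le_lt_trans (lerD h1 h2) ee.
have dd (x : R) : x + e - (x - e) = e + e by ring.
by rewrite !dd leNgt eM.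
Qed.

End PuncturedGoursat.

(** * Cauchy's formula on a square *)

Lemma continuous_div (K : numFieldType) (f g : K -> K) (z : K) :
  {for z, continuous f} -> {for z, continuous g} -> g z != 0 ->
  {for z, continuous (fun u => f u / g u)}.
Proof. by move=> cf cg g0; exact: (cvgM cf (cvgV g0 cg)). Qed.

Lemma continuous_mul (K : numFieldType) (f g : K -> K) (z : K) :
  {for z, continuous f} -> {for z, continuous g} ->
  {for z, continuous (fun u => f u * g u)}.
Proof. by move=> cf cg; exact: (cvgM cf cg). Qed.

Lemma continuous_scale (K : numFieldType) (c : K) (f : K -> K) (z : K) :
  {for z, continuous f} -> {for z, continuous (fun u => c * f u)}.
Proof. by move=> cf; exact: (cvgM (cvg_cst c) cf). Qed.

Lemma continuous_exprn (K : numFieldType) (z : K) k :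
  {for z, continuous (fun u : K => u ^+ k : K)}.
Proof.
elim: k => [|k IH].
  have -> : (fun u : K => u ^+ 0) = cst 1 by apply/funext => u; rewrite expr0.
  exact: cst_continuous.
have -> : (fun u : K => u ^+ k.+1) = (fun u : K => u * u ^+ k).
  by apply/funext => u; rewrite exprS.
by apply: (@continuous_mul K id _ z _ IH); exact: cvg_id.
Qed.

Lemma continuous_subX (K : numFieldType) (a z : K) k :
  {for z, continuous (fun u : K => u ^+ k * (u - a) : K)}.
Proof.
apply: (@continuous_mul K (fun u => u ^+ k) (fun u => u - a)); first exact: continuous_exprn.
exact: (cvgB (@cvg_id _ _) (cvg_cst _)).
Qed.

Lemma derivable_divdiff (K : numFieldType) (f : K -> K) (a z : K) :
  derivable f z 1 -> z != a -> derivable (fun u => (f u - f a) / (u - a)) z 1.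
Proof.
move=> df za.
have d1 := derivableB df (derivable_cst (f a) z 1).
have d2 := derivableB (@derivable_id _ _ z 1) (derivable_cst a z 1).
by apply: (derivableM d1); apply: derivableV d2; rewrite subr_eq0.
Qed.

Lemma continuousC_cst (R : realType) (X : topologicalType) (c : R[i]) (t : X) :
  {for t, continuous (fun=> c)}.
Proof. by apply/continuousC_dist => e e0; near=> u; rewrite subrr normc0.
Unshelve. all: by end_near. Qed.

Section CauchyExpansion.
Context {R : realType}.
Local Notation C := (R[i]^o).
Variable s : R.
Hypothesis s0 : 0 < s.
Implicit Types (f : R[i] -> R[i]) (a z : R[i]) (M : R).

Local Notation F := (frame (- s) s (- s) s).
Local Notation I f := (rect_int f (- s) s (- s) s).

Let sNs : - s <= s. Proof. by move: s0 => h; lra. Qed.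

Lemma frame_normc_ge z : F z -> s <= normc z.
Proof.
have h1 := normc_Re_le z; have h2 := normc_Im_le z => -[_ []] E.
- by apply: le_trans h1; rewrite E normrN ler_norm.
- by apply: le_trans h1; rewrite E ler_norm.
- by apply: le_trans h2; rewrite E normrN ler_norm.
- by apply: le_trans h2; rewrite E ler_norm.
Qed.

Lemma frame_normc_sub a z : normc a <= s / 2 -> F z -> s / 2 <= normc (z - a).
Proof.
move=> ha /frame_normc_ge hz.
have := normcD_le (z - a) a; rewrite subrK; lra.
Qed.

Lemma frame_neq0 z : F z -> z != 0.
Proof. by move/frame_normc_ge => h; rewrite -normc_gt0; exact: lt_le_trans h. Qed.

Lemma frame_sub_neq0 a z : normc a <= s / 2 -> F z -> z - a != 0.
Proof.
move=> ha /(frame_normc_sub ha) h; rewrite -normc_gt0; apply: lt_le_trans h.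
by rewrite divr_gt0.
Qed.

Lemma continuous_kernel f a z k : {for z, continuous f} -> normc a <= s / 2 ->
  F z -> {for z, continuous (fun u => f u / (u ^+ k * (u - a)))}.
Proof.
move=> cf ha zF.
have g0 : z ^+ k * (z - a) != 0.
  by apply: mulf_neq0; [apply: expf_neq0; exact: frame_neq0|exact: frame_sub_neq0 zF].
exact: (@continuous_div R[i] f _ z cf (@continuous_subX R[i] a z k) g0).
Qed.

Lemma normc00_le : normc (0 : R[i]) <= s / 2.
Proof. by rewrite normc0 divr_ge0// ltW. Qed.

Lemma continuous_moment f z k : {for z, continuous f} ->
  F z -> {for z, continuous (fun u => f u / u ^+ k.+1)}.
Proof.
move=> cf zF; have := @continuous_kernel f 0 z k cf normc00_le zF.
rewrite (_ : (fun u => f u / (u ^+ k * (u - 0))) = (fun u => f u / u ^+ k.+1))//.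
by apply/funext => u; rewrite subr0 exprSr.
Qed.

Lemma kernel_le f a M k : (forall z, F z -> {for z, continuous f}) ->
  normc a <= s / 2 -> (forall z, F z -> normc (f z) <= M) ->
  normc (I (fun u => f u / (u ^+ k * (u - a)))) <= 32 * M / s ^+ k.
Proof.
move=> cf ha fM.
have sk : 0 < s ^+ k by rewrite exprn_gt0.
have -> : 32 * M / s ^+ k = 4 * (M / (s ^+ k * (s / 2))) * (s - - s + (s - - s)).
  by field; rewrite !gt_eqF.
apply: rect_int_le; [exact: sNs|exact: sNs| |] => z zF.
  exact: continuous_kernel (cf z zF) ha zF.
rewrite normcM normcV normcM normcX.
have h1 := frame_normc_ge zF; have h2 := frame_normc_sub ha zF.
have s2 : 0 < s / 2 by rewrite divr_gt0.
apply: ler_pM; rewrite ?normc_ge0 ?fM//.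
  by rewrite invr_ge0 mulr_ge0 ?exprn_ge0 ?normc_ge0.
rewrite lef_pV2 ?posrE ?mulr_gt0 ?exprn_gt0 ?(lt_le_trans _ h1) ?(lt_le_trans _ h2)//.
apply: ler_pM; [exact: ltW|exact: ltW| |exact: h2].
by rewrite lerXn2r// nnegrE ?ltW// (lt_le_trans s0).
Qed.

Lemma moment_le f M k : (forall z, F z -> {for z, continuous f}) ->
  (forall z, F z -> normc (f z) <= M) ->
  normc (I (fun u => f u / u ^+ k.+1)) <= 16 * M / s ^+ k.
Proof.
move=> cf fM.
have sk : 0 < s ^+ k by rewrite exprn_gt0.
have -> : 16 * M / s ^+ k = 4 * (M / s ^+ k.+1) * (s - - s + (s - - s)).
  by rewrite exprS; field; rewrite !gt_eqF.
apply: rect_int_le; [exact: sNs|exact: sNs| |] => z zF.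
  exact: continuous_moment (cf z zF) zF.
rewrite normcM normcV normcX.
have h1 := frame_normc_ge zF.
apply: ler_pM; rewrite ?normc_ge0 ?fM//.
  by rewrite invr_ge0 exprn_ge0 ?normc_ge0.
rewrite lef_pV2 ?posrE ?exprn_gt0 ?(lt_le_trans _ h1)//.
by rewrite lerXn2r// nnegrE ?ltW// (lt_le_trans s0).
Qed.

Lemma kernel_expansion f a : (forall z, F z -> {for z, continuous f}) ->
  normc a <= s / 2 ->
  I (fun u => f u / (u - a)) =
  I (fun u => f u / u ^+ 1) + a * I (fun u => f u / u ^+ 2) +
  a ^+ 2 * I (fun u => f u / u ^+ 3) +
  a ^+ 3 * I (fun u => f u / (u ^+ 3 * (u - a))).
Proof.
move=> cf ha.
have cm k z (zF : F z) := @continuous_moment f z k (cf z zF) zF.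
have ck z (zF : F z) := @continuous_kernel f a z 3 (cf z zF) ha zF.
have cZ c (h : R[i] -> R[i]) : (forall z, F z -> {for z, continuous h}) ->
    forall z, F z -> {for z, continuous (fun u => c * h u)}.
  move=> ch z zF; exact: (@continuous_scale R[i] c h z (ch z zF)).
have cD (h1 h2 : R[i] -> R[i]) : (forall z, F z -> {for z, continuous h1}) ->
    (forall z, F z -> {for z, continuous h2}) ->
    forall z, F z -> {for z, continuous (fun u => h1 u + h2 u)}.
  move=> c1 c2 z zF; exact: (continuousC_add (c1 z zF) (c2 z zF)).
have c1 := cZ a _ (cm 1%N); have c2 := cZ (a ^+ 2) _ (cm 2%N).
have c3 := cZ (a ^+ 3) _ ck; have c01 := cD _ _ (cm 0%N) c1.
have c012 := cD _ _ c01 c2.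
rewrite -(rect_intZ sNs sNs _ (cm 1%N)) -(rect_intZ sNs sNs _ (cm 2%N)).
rewrite -(rect_intZ sNs sNs _ ck).
rewrite -(rect_intD sNs sNs (cm 0%N) c1) -(rect_intD sNs sNs c01 c2).
rewrite -(rect_intD sNs sNs c012 c3).
apply: eq_rect_int; [exact: sNs|exact: sNs|] => z /set_mem zF.
have z0 := frame_neq0 zF; have za := frame_sub_neq0 ha zF.
by field; rewrite za z0.
Qed.

End CauchyExpansion.

Section CauchyKernelMoments.
Context {R : realType}.
Variable s : R.
Hypothesis s0 : 0 < s.
Local Notation I f := (rect_int f (- s) s (- s) s).

Let sNs : - s <= s. Proof. by move: s0 => h; lra. Qed.

Let low k := cintegral (fun x : R => ((x +i* (- s)) ^+ k.+1)^-1) (- s) s.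
Let high k := cintegral (fun x : R => ((x +i* s) ^+ k.+1)^-1) (- s) s.

Lemma cintegral_opp (g : R -> R[i]) (b : R) : 0 <= b -> {in `[- b, b], continuous g} ->
  cintegral (fun t => g (- t)) (- b) b = cintegral g (- b) b.
Proof.
move=> b0 cg.
have opp (k : R[i] -> R) : continuous k ->
    \int[lebesgue_measure]_(t in `[- b, b]) k (g (- t)) =
    \int[lebesgue_measure]_(t in `[- b, b]) k (g t).
  move=> ck; have bb : - b <= b by lra.
  have := @integration_by_substitution_oppr R (k \o g) (- b) b bb.
  rewrite opprK => H; rewrite /Rintegral; congr fine; apply/esym; apply: H.
  apply: continuous_in_subspaceT => t /set_mem /= tab.
  by apply: continuous_comp; [exact: cg|exact: ck].
by congr (_ +i* _); apply: opp; [exact: continuous_Re|exact: continuous_Im].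
Qed.

Lemma moment_frame_continuous k z : frame (- s) s (- s) s z ->
  {for z, continuous (fun u : R[i] => (u ^+ k.+1)^-1)}.
Proof.
move=> zF.
have -> : (fun u : R[i] => (u ^+ k.+1)^-1) = (fun u : R[i] => 1 / u ^+ k.+1).
  by apply/funext => u; rewrite mul1r.
exact: (@continuous_moment R s s0 (fun=> 1) z k (@continuousC_cst R _ _ _) zF).
Qed.

Let sides k := side_continuous sNs sNs (@moment_frame_continuous k).

Lemma inv_moment k :
  I (fun u : R[i] => (u ^+ k.+1)^-1) = (1 + 'i%C * ('i%C ^+ k.+1)^-1) * (low k - high k).
Proof.
have [c1 c2 c3 c4] := sides k.
have e1 : cintegral (fun y : R => ((s +i* y) ^+ k.+1)^-1) (- s) s =
    ('i%C ^+ k.+1)^-1 * low k.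
  rewrite -cintegralZ; last exact: c1.
  apply: eq_cintegral => y _; rewrite -invfM -exprMn; congr ((_ ^+ _)^-1).
  by rewrite mulcE; congr (_ +i* _); ring.
have e2 : cintegral (fun y : R => ((- s +i* y) ^+ k.+1)^-1) (- s) s =
    ('i%C ^+ k.+1)^-1 * high k.
  rewrite -cintegralZ; last exact: c2.
  apply: eq_cintegral => y _; rewrite -invfM -exprMn; congr ((_ ^+ _)^-1).
  by rewrite mulcE; congr (_ +i* _); ring.
apply: (@etrans _ _ (low k - high k + 'i%C *
    (('i%C ^+ k.+1)^-1 * low k - ('i%C ^+ k.+1)^-1 * high k))).
  by congr (_ + 'i%C * (_ - _)); [exact: e1|exact: e2].
by move: (low k) (high k) => A B; ring.
Qed.

Lemma inv_moment1 : I (fun u : R[i] => (u ^+ 2)^-1) = 0.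
Proof.
have [_ c2 _ _] := sides 1.
rewrite inv_moment [low 1](_ : _ = high 1) ?subrr ?mulr0// /low /high.
rewrite -(cintegral_opp (ltW s0) c2); apply: eq_cintegral => x _.
by congr (_^-1); rewrite !expr2 !mulcE; congr (_ +i* _); ring.
Qed.

Lemma inv_moment2 : I (fun u : R[i] => (u ^+ 3)^-1) = 0.
Proof.
rewrite inv_moment [X in X * _](_ : _ = 0) ?mul0r//.
have i2 : ('i%C : R[i]) ^+ 2 = -1 by rewrite sqr_i.
have i0 : ('i%C : R[i]) != 0 by rewrite -normc_eq0 normc_i oner_eq0.
rewrite exprS invfM mulrA divff// mul1r i2 invrN invr1; ring.
Qed.

Lemma inv_moment0_ge : 4 <= normc (I (fun u : R[i] => (u ^+ 1)^-1)).
Proof.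
have [c1 c2 _ _] := sides 0.
have i0 : ('i%C : R[i]) != 0 by rewrite -normc_eq0 normc_i oner_eq0.
rewrite inv_moment expr1 divff// normcM.
have -> : normc ((1 : R[i]) + 1) = 2.
  by rewrite (_ : (1 : R[i]) + 1 = (2 : R)%:C) ?normc_real ?ger0_norm// rmorphD.
rewrite (_ : 4 = 2 * 2 :> R) ?ler_pM2l//; last by ring.
apply: le_trans (normc_Im_le _); apply: le_trans (ler_norm _).
rewrite raddfB.
have [_ i1] := cintegral_integrable c1; have [_ i2] := cintegral_integrable c2.
have cst_int c : lebesgue_measure.-integrable `[- s, s] (EFin \o (cst c : R -> R)).
  apply/continuous_compact_integrable; first exact: segment_compact.
  by apply: continuous_subspaceT => ?; exact: cvg_cst.
have cstE c : \int[lebesgue_measure]_(t in `[- s, s]) (cst c : R -> R) t = 2 * s * c.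
  rewrite Rintegral_cst//= lebesgue_measure_itv/= lte_fin.
  rewrite (_ : - s < s); last by move: s0 => h; lra.
  by rewrite /= opprK; ring.
have bd x : x \in `[- s, s] -> (2 * s)^-1 <= s / (x ^+ 2 + s ^+ 2).
  rewrite in_itv/= => /andP[x1 x2].
  have x2s : x ^+ 2 <= s ^+ 2.
    by rewrite -(real_normK (num_real x)) lerXn2r ?nnegrE ?(ltW s0)// ler_norml x1.
  have s2 : 0 < s ^+ 2 by rewrite exprn_gt0.
  have h0 : 0 < x ^+ 2 + s ^+ 2 by rewrite ltr_wpDl// sqr_ge0.
  have s20 : 0 < 2 * s by rewrite mulr_gt0.
  rewrite ler_pdivlMr// mulrC ler_pdivrMr//.
  by rewrite (_ : s * (2 * s) = s ^+ 2 + s ^+ 2) ?lerD2r//; ring.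
have E (x y : R) : complex.Im ((x +i* y)^-1) = - (y / (x ^+ 2 + y ^+ 2)) by [].
have lo : 1 <= \int[lebesgue_measure]_(t in `[- s, s])
    complex.Im (((t +i* (- s)) ^+ 1)^-1).
  have -> : 1 = 2 * s * (2 * s)^-1 by rewrite divff// gt_eqF// mulr_gt0.
  rewrite -cstE; apply: le_Rintegral; [by []|exact: cst_int|exact: i1|].
  by move=> x xs; rewrite expr1 E sqrrN mulNr opprK; exact: bd.
have hi : \int[lebesgue_measure]_(t in `[- s, s])
    complex.Im (((t +i* s) ^+ 1)^-1) <= -1.
  have -> : -1 = 2 * s * - (2 * s)^-1 by rewrite mulrN divff// gt_eqF// mulr_gt0.
  rewrite -cstE; apply: le_Rintegral; [by []|exact: i2|exact: cst_int|].
  by move=> x xs; rewrite expr1 E lerN2; exact: bd.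
apply: (@le_trans _ _ (1 - -1)); first by rewrite opprK.
exact: (lerB lo hi).
Qed.

End CauchyKernelMoments.

Lemma quadratic_quotient (K : fieldType) (F j a m0 m1 m2 r r1 : K) : j != 0 ->
  m0 + a * m1 + a ^+ 2 * m2 + a ^+ 3 * r = F * (j + a ^+ 3 * r1) ->
  F - (m0 / j + m1 / j * a + m2 / j * a ^+ 2) = a ^+ 3 * (r - F * r1) / j.
Proof.
move=> j0 h.
have -> : m0 = F * (j + a ^+ 3 * r1) - a * m1 - a ^+ 2 * m2 - a ^+ 3 * r.
  by rewrite -h; ring.
by field.
Qed.

Section CauchyEstimate.
Context {R : realType}.
Local Notation C := (R[i]^o).
Variable s : R.
Hypothesis s0 : 0 < s.
Implicit Types (f : R[i] -> R[i]) (a z : R[i]) (M : R).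
Local Notation F := (frame (- s) s (- s) s).
Local Notation I f := (rect_int f (- s) s (- s) s).

Let sNs : - s <= s. Proof. by move: s0 => h; lra. Qed.

Lemma cauchy_formula f a :
  (forall z, in_rect (- s) s (- s) s z -> derivable (f : C -> C) z 1) ->
  normc a <= s / 2 ->
  I (fun u => f u / (u - a)) = f a * I (fun u => 1 / (u - a)).
Proof.
move=> df ha.
have s2 : s / 2 < s by move: s0 => h; lra.
have [ha1 ha2] : (- s < complex.Re a < s) /\ (- s < complex.Im a < s).
  rewrite -!ltr_norml; split; apply: le_lt_trans s2; apply: le_trans ha.
  - exact: normc_Re_le.
  - exact: normc_Im_le.
have ain : in_rect (- s) s (- s) s a.
  by split; apply/andP; split; apply: ltW; case/andP: ha1; case/andP: ha2.
have cF z : F z -> {for z, continuous f}.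
  by move=> zF; apply: derivableC_continuous; apply: df; exact: frame_in_rect.
have ck (h : R[i] -> R[i]) : (forall z, F z -> {for z, continuous h}) ->
    forall z, F z -> {for z, continuous (fun u => h u / (u - a))}.
  move=> ch z zF; have := @continuous_kernel R s s0 h a z 0 (ch z zF) ha zF.
  rewrite (_ : (fun u => h u / (u ^+ 0 * (u - a))) = (fun u => h u / (u - a)))//.
  by apply/funext => u; rewrite expr0 mul1r.
have c1 z : F z -> {for z, continuous (fun=> 1 : R[i])} by move=> _; exact: continuousC_cst.
pose g z := (f z - f a) / (z - a).
have Ig : I g = 0.
  apply: (@rect_int_punctured_eq0 _ g _ _ _ _ a) => //.
    by move=> z zin za; exact: (@derivable_divdiff R[i] f a z (df z zin) za).
  have [l /(_ 1 ltr01)[d d0 Hd]] := derivableC_dist (df a ain).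
  exists (1 + normc l), d => // z za /Hd.
  have za0 : 0 < normc (z - a) by rewrite normc_gt0 subr_eq0.
  rewrite /g normcM normcV ler_pdivrMr// mul1r mulrDl mul1r => h.
  rewrite (_ : f z - f a = (f z - (f a + l * (z - a))) + l * (z - a)); last by ring.
  by apply: le_trans (normcD_le _ _) _; rewrite normcM lerD2r.
have cg z : F z -> {for z, continuous g}.
  apply: (ck (fun u => f u - f a)) => {}z zF.
  by apply: continuousC_add; [exact: cF|exact: continuousC_cst].
have c1a := ck _ c1.
have cfa z (zF : F z) := @continuous_scale R[i] (f a) _ z (c1a z zF).
rewrite -(rect_intZ sNs sNs (f a) c1a) -[RHS]add0r -Ig -(rect_intD sNs sNs cg cfa).
apply: eq_rect_int; [exact: sNs|exact: sNs|] => z /set_mem zF.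
by rewrite /g; field; rewrite (frame_sub_neq0 s0 ha zF).
Qed.

(* Cauchy's formula gives [f a] as the quotient of the integrals of
   [f z / (z - a)] and [1 / (z - a)]. The invariance of the square under
   [z -> i z] and [z -> - z] kills the terms in [a] and [a ^+ 2] of the
   denominator, so its value [2 i pi] is never needed, only a lower bound. *)
Theorem cauchy_quadratic_expansion f M :
  (forall z, in_rect (- s) s (- s) s z -> derivable (f : C -> C) z 1) ->
  (forall z, in_rect (- s) s (- s) s z -> normc (f z) <= M) ->
  exists c1 c2, normc c1 <= 4 * M / s /\
    forall a, normc a <= s / 2 ->
      normc (f a - (f 0 + c1 * a + c2 * a ^+ 2)) <= 16 * M / s ^+ 3 * normc a ^+ 3.
Proof.
move=> df fM.
have s3 : 0 < s ^+ 3 by rewrite exprn_gt0.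
have cF z : F z -> {for z, continuous f}.
  by move=> zF; apply: derivableC_continuous; apply: df; exact: frame_in_rect.
have fMF z : F z -> normc (f z) <= M by move=> zF; apply: fM; exact: frame_in_rect.
have c1 z : F z -> {for z, continuous (fun=> 1 : R[i])} by move=> _; exact: continuousC_cst.
pose j := I (fun u : R[i] => (u ^+ 1)^-1).
have j4 : 4 <= normc j by exact: inv_moment0_ge.
have j_gt0 : 0 < normc j by apply: lt_le_trans j4.
have j0 : j != 0 by rewrite -normc_gt0.
pose m k := I (fun u => f u / u ^+ k.+1).
have key a : normc a <= s / 2 ->
    normc (f a - (m 0%N / j + m 1%N / j * a + m 2 / j * a ^+ 2)) <=
    16 * M / s ^+ 3 * normc a ^+ 3.
  move=> ha.
  have := cauchy_formula df ha.
  rewrite (kernel_expansion s0 cF ha) (kernel_expansion s0 c1 ha).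
  have E k : (fun u : R[i] => 1 / u ^+ k.+1) = (fun u : R[i] => (u ^+ k.+1)^-1).
    by apply/funext => u; rewrite mul1r.
  rewrite !E (inv_moment1 s0) (inv_moment2 s0) !mulr0 !addr0 -/j -!/(m _).
  set r := I _; set r1 := I _ => h.
  have rM : normc r <= 32 * M / s ^+ 3 by exact: kernel_le.
  have r1M : normc r1 <= 32 * 1 / s ^+ 3.
    by apply: kernel_le => // z _; rewrite normc1.
  have -> : f a - (m 0%N / j + m 1%N / j * a + m 2 / j * a ^+ 2) =
      a ^+ 3 * (r - f a * r1) / j.
    exact: quadratic_quotient.
  rewrite normcM normcV normcM normcX ler_pdivrMr//.
  have h1 : normc (r - f a * r1) <= 64 * M / s ^+ 3.
    apply: le_trans (normcB_le _ _) _; rewrite normcM.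
    have fa : normc (f a) <= M.
      apply: fM; have s2 : s / 2 <= s by move: s0 => h'; lra.
      split; rewrite -ler_norml; apply: le_trans s2; apply: le_trans ha.
      - exact: normc_Re_le.
      - exact: normc_Im_le.
    have h2 : normc (f a) * normc r1 <= M * (32 * 1 / s ^+ 3).
      by apply: ler_pM => //; exact: normc_ge0.
    apply: le_trans (lerD rM h2) _.
    by rewrite le_eqVlt; apply/orP; left; apply/eqP; ring.
  have M0 : 0 <= M.
    apply: le_trans (normc_ge0 (f 0)) (fM _ _).
    by split; rewrite /= oppr_le0 (ltW s0).
  have a3 : 0 <= normc a ^+ 3 by rewrite exprn_ge0// normc_ge0.
  apply: le_trans (ler_wpM2l a3 h1) _.
  have -> : normc a ^+ 3 * (64 * M / s ^+ 3) = 16 * M / s ^+ 3 * normc a ^+ 3 * 4.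
    by move: (normc a ^+ 3) (s ^+ 3)^-1 => u v; ring.
  apply: ler_wpM2l j4; apply: mulr_ge0 => //; apply: divr_ge0; last exact: ltW.
  exact: mulr_ge0.
exists (m 1%N / j), (m 2 / j).
have f0 : f 0 = m 0%N / j.
  have := key 0; rewrite normc0 divr_ge0 ?(ltW s0)// => /(_ isT).
  rewrite !expr0n/= !mulr0 !addr0 => h.
  by apply/eqP; rewrite -subr_eq0 -normc_eq0 eq_le h normc_ge0.
split; last by move=> a /key; rewrite f0.
rewrite normcM normcV ler_pdivrMr//.
have := moment_le s0 1 cF fMF; rewrite expr1 => /le_trans; apply.
have M0 : 0 <= 4 * M / s.
  rewrite divr_ge0 ?(ltW s0)// mulr_ge0//.
  apply: le_trans (normc_ge0 (f 0)) (fM _ _).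
  by split; rewrite /= oppr_le0 (ltW s0).
by apply: le_trans (ler_wpM2l M0 j4); rewrite le_eqVlt; apply/orP; left; apply/eqP; ring.
Qed.

End CauchyEstimate.

(** * Second derivatives of holomorphic functions of several variables *)

Section DirectionalDerivatives.
Context {K : numFieldType} {V W : normedModType K}.
Implicit Types (f : V -> W) (z v : V) (t : K).

Lemma derivable_line f z v t : derivable f (z + t *: v) v ->
  derivable (fun t => f (z + t *: v)) t 1.
Proof.
rewrite /derivable/= => df.
rewrite (_ : (fun h => _) = (fun h => h^-1 *: (f (h *: v + (z + t *: v)) - f (z + t *: v))))//.
apply/funext => h; congr (_ *: (f _ - _)).
by rewrite scaler1 scalerDl addrCA.
Qed.

Lemma cvg_derive_of_bound f z v (c : W) (L d : K) : 0 < d -> 0 <= L ->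
  (forall h, `|h| < d -> `|f (h *: v + z) - f z - h *: c| <= L * `|h| ^+ 2) ->
  h^-1 *: (f (h *: v + z) - f z) @[h --> 0^'] --> c.
Proof.
move=> d0 L0 H; apply/cvgrPdist_le => e e0; near=> h.
have h0 : h != 0 by near: h; exact: nbhs_dnbhs_neq.
have hd : `|h| < d by near: h; apply: dnbhs0_lt.
have he : `|h| < e / (L + 1).
  by near: h; apply: dnbhs0_lt; rewrite divr_gt0// ltr_wpDl.
have -> : c - h^-1 *: (f (h *: v + z) - f z) =
    - (h^-1 *: (f (h *: v + z) - f z - h *: c)).
  by rewrite [in RHS]scalerBr scalerA mulVf// scale1r opprB.
rewrite normrN normrZ normfV ler_pdivrMl ?normr_gt0//.
apply: le_trans (H h hd) _; rewrite expr2 mulrCA ler_wpM2l//.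
have : `|h| * (L + 1) <= e by rewrite -ler_pdivlMr ?ltr_wpDl// ltW.
by apply: le_trans; rewrite mulrC ler_wpM2l// lerDl.
Unshelve. all: by end_near. Qed.

Lemma derive_of_bound f z v (c : W) (L d : K) : 0 < d -> 0 <= L ->
  (forall h, `|h| < d -> `|f (h *: v + z) - f z - h *: c| <= L * `|h| ^+ 2) ->
  derivable f z v /\ 'D_v f z = c.
Proof.
move=> d0 L0 /(cvg_derive_of_bound d0 L0) H; split; last exact: cvg_lim H.
by apply/cvg_ex; exists c.
Qed.

End DirectionalDerivatives.

Section ComplexDirections.
Context {R : realType} {V : normedModType R[i]}.
Local Notation C := (R[i]^o).
Implicit Types (f : V -> R[i]) (z u v w : V) (s t : R[i]).

Lemma gt0_real_complex (x : R[i]) : 0 < x -> exists2 y : R, 0 < y & x = y%:C.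
Proof. by case: x => a b; rewrite ltcE/= => /andP[/eqP-> a0]; exists a. Qed.

Lemma in_square_normc (s : R) t : in_rect (- s) s (- s) s t -> normc t <= 2 * s.
Proof.
move=> [h1 h2]; apply: le_trans (normc_le_ReIm t) _.
by rewrite mulr2n mulrDl mul1r lerD// ler_norml.
Qed.

Lemma taylor_line f z v (s M : R) : 0 < s ->
  (forall t, normc t <= 2 * s -> derivable (f : V -> C) (z + t *: v) v /\
     normc (f (z + t *: v)) <= M) ->
  normc ('D_v (f : V -> C) z) <= 4 * M / s /\
  exists c, forall t, normc t <= s / 2 ->
    normc (f (z + t *: v) - (f z + 'D_v (f : V -> C) z * t + c * t ^+ 2)) <=
    16 * M / s ^+ 3 * normc t ^+ 3.
Proof.
move=> s0 Hf.
pose phi t := f (z + t *: v).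
have dphi t : in_rect (- s) s (- s) s t -> derivable (phi : C -> C) t 1.
  move=> /in_square_normc /Hf[df _].
  exact: (@derivable_line R[i] V C f z v t df).
have bphi t : in_rect (- s) s (- s) s t -> normc (phi t) <= M.
  by move=> /in_square_normc /Hf[].
have [c1 [c2 [c1M Hc]]] := cauchy_quadratic_expansion s0 dphi bphi.
have phi0 : phi 0 = f z by rewrite /phi scale0r addr0.
rewrite phi0 in Hc.
have M0 : 0 <= M.
  apply: le_trans (normc_ge0 (phi 0)) (bphi 0 _).
  by split; rewrite /= oppr_le0 (ltW s0).
have E0 : 0 <= 16 * M / s ^+ 3 by rewrite divr_ge0 ?mulr_ge0 ?exprn_ge0 ?(ltW s0).
pose L := normc c2 + 16 * M / s ^+ 3 * (s / 2).
have L0 : 0 <= L by rewrite addr_ge0 ?normc_ge0// mulr_ge0// divr_ge0 ?(ltW s0).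
have [_ D1] : derivable (f : V -> C) z v /\ 'D_v (f : V -> C) z = c1.
  apply: (@derive_of_bound R[i] V C f z v c1 L%:C (s / 2)%:C).
  - by rewrite ltcR divr_gt0.
  - by rewrite lecR.
  - move=> h; change (is_true ((normc h)%:C < (s / 2)%:C) ->
      is_true ((normc (f (h *: v + z) - f z - h * c1))%:C <= L%:C * (normc h)%:C ^+ 2)).
    rewrite ltcR -rmorphXn -rmorphM lecR => /ltW hs.
    have := Hc h hs; rewrite /phi [h *: v + z]addrC.
    set F := f _ => hh.
    have -> : F - f z - h * c1 =
        (F - (f z + c1 * h + c2 * h ^+ 2)) + c2 * h ^+ 2 by ring.
    apply: le_trans (normcD_le _ _) _; rewrite normcM normcX.
    rewrite /L mulrDl addrC; apply: lerD => //; apply: le_trans hh _.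
    move: (16 * M / s ^+ 3) E0 => E E0; rewrite exprS -!mulrA ler_wpM2l// mulrA.
    by apply: ler_wpM2r; [exact: sqr_ge0|].
rewrite D1; split=> //.
by exists c2.
Qed.

(* Polarisation: expand [f] from [w] along [u + v] and [u - v], and from
   [w + h *: u] along [v]; the four expansions at parameter [h] or [- h] meet at
   the same two points. *)
Lemma second_derivable f w u v (r M : R) : 0 < r ->
  (forall z, `|z - w| < r%:C -> (forall x, derivable (f : V -> C) z x) /\
     normc (f z) <= M) ->
  'D_(u + v) (f : V -> C) w - 'D_(u - v) (f : V -> C) w =
    2 * 'D_v (f : V -> C) w ->
  derivable ('D_v (f : V -> C)) w u.
Proof.
move=> r0 Hf Duv.
have N0 : 0 < `|u| + `|v| + 1 by rewrite ltr_wpDl// addr_ge0.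
have [N N_gt0 NE] := gt0_real_complex N0.
pose s := r / (4 * N).
have s0 : 0 < s by rewrite divr_gt0// mulr_gt0.
have inball a b : normc a <= 2 * s -> normc b <= 2 * s ->
    `|a *: u + b *: v| < r%:C.
  move=> ha hb.
  have hn (x : R[i]) : normc x <= 2 * s -> `|x| <= (2 * s)%:C by rewrite -lecR.
  have s2 : 0 <= (2 * s)%:C by rewrite lecR mulr_ge0// ltW.
  have := ler_normD (a *: u) (b *: v); rewrite !normrZ => /le_lt_trans; apply.
  apply: (@le_lt_trans _ _ ((2 * s)%:C * (`|u| + `|v|))).
    by rewrite mulrDr; apply: lerD; apply: ler_wpM2r => //; exact: hn.
  apply: (@lt_le_trans _ _ ((2 * s)%:C * (`|u| + `|v| + 1))).
    by rewrite ltr_pM2l ?ltrDl// ltcR mulr_gt0.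
  rewrite NE -rmorphM lecR /s.
  rewrite (_ : 2 * (r / (4 * N)) * N = r / 2); last by field; rewrite gt_eqF.
  by clear -r0; lra.
pose E := 16 * M / s ^+ 3.
have [_ [bp Hp]] : normc ('D_(u + v) (f : V -> C) w) <= 4 * M / s /\ exists c,
    forall t, normc t <= s / 2 -> normc (f (w + t *: (u + v)) -
      (f w + 'D_(u + v) (f : V -> C) w * t + c * t ^+ 2)) <= E * normc t ^+ 3.
  apply: taylor_line => // t ht.
  have [|h1 h2] := Hf (w + t *: (u + v)); last by split.
  by rewrite addrC addKr scalerDr inball.
have [_ [bm Hm]] : normc ('D_(u - v) (f : V -> C) w) <= 4 * M / s /\ exists c,
    forall t, normc t <= s / 2 -> normc (f (w + t *: (u - v)) -
      (f w + 'D_(u - v) (f : V -> C) w * t + c * t ^+ 2)) <= E * normc t ^+ 3.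
  apply: taylor_line => // t ht.
  have [|h1 h2] := Hf (w + t *: (u - v)); last by split.
  by rewrite addrC addKr scalerBr -scaleNr inball// normcN.
have Hs h : normc h <= s / 2 -> exists c, forall t, normc t <= s / 2 ->
    normc (f (w + h *: u + t *: v) -
      (f (w + h *: u) + 'D_v (f : V -> C) (w + h *: u) * t + c * t ^+ 2)) <=
    E * normc t ^+ 3.
  move=> hh.
  suff [] : normc ('D_v (f : V -> C) (w + h *: u)) <= 4 * M / s /\ exists c,
    forall t, normc t <= s / 2 -> normc (f (w + h *: u + t *: v) -
      (f (w + h *: u) + 'D_v (f : V -> C) (w + h *: u) * t + c * t ^+ 2)) <=
      E * normc t ^+ 3 by [].
  apply: taylor_line => // t ht.
  have [|h1 h2] := Hf (w + h *: u + t *: v); last by split.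
  have -> : w + h *: u + t *: v - w = h *: u + t *: v.
    by rewrite -(addrA w) (addrC w) addrK.
  rewrite inball//; apply: le_trans hh _.
  by move: s0 => h'; lra.
have M0 : 0 <= M.
  have [|_] := Hf w; first by rewrite subrr normr0 ltcR.
  exact: le_trans (normc_ge0 _).
have E0 : 0 <= E.
  by apply: divr_ge0; [exact: mulr_ge0|apply: exprn_ge0; exact: ltW].
pose c := (bp - bm) / 2.
suff [] : derivable ('D_v (f : V -> C)) w u /\ 'D_u ('D_v (f : V -> C)) w = c by [].
apply: (@derive_of_bound R[i] V C ('D_v (f : V -> C)) w u c (2 * E)%:C (s / 2)%:C).
- by rewrite ltcR divr_gt0.
- by rewrite lecR mulr_ge0.
move=> h; rewrite [h *: u + w]addrC.
change (is_true ((normc h)%:C < (s / 2)%:C) ->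
  is_true ((normc ('D_v (f : V -> C) (w + h *: u) - 'D_v (f : V -> C) w - h * c))%:C <=
           (2 * E)%:C * (normc h)%:C ^+ 2)).
rewrite ltcR -rmorphXn -rmorphM lecR => /ltW hs.
have [->|h0] := eqVneq h 0.
  by rewrite scale0r addr0 subrr mul0r subrr !normc0 expr0n mulr0.
have [b Hb] := Hs h hs.
have hNs : normc (- h) <= s / 2 by rewrite normcN.
move: (Hb h hs) (Hb (- h) hNs) (Hp h hs) (Hm h hs) => {Hb Hp Hm}.
rewrite normcN scalerDr scalerBr scaleNr !addrA.
set D := 'D_v _ (w + h *: u); set D0 := 'D_v _ w.
set Fp := f (w + h *: u + h *: v); set Fm := f (w + h *: u - h *: v).
rewrite -/D0 in Duv.
set F := f (w + h *: u); set F0 := f w.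
move: Duv; set Dp := 'D_(u + v) _ w; set Dm := 'D_(u - v) _ w => Duv.
move=> k1 k2 k3 k4.
have n0 : 0 < 2 * normc h by rewrite mulr_gt0// normc_gt0.
rewrite -(ler_pM2l n0).
have -> : 2 * normc h * normc (D - D0 - h * c) =
    normc (2 * h * (D - D0 - h * c)).
  rewrite !normcM (_ : (2 : R[i]) = (2 : R)%:C) ?normc_real ?ger0_norm//.
  by rewrite rmorphMn rmorph1.
have -> : 2 * h * (D - D0 - h * c) =
    - (Fp - (F + D * h + b * h ^+ 2)) + (Fm - (F + D * - h + b * (- h) ^+ 2)) +
    ((Fp - (F0 + Dp * h + bp * h ^+ 2)) - (Fm - (F0 + Dm * h + bm * h ^+ 2))).
  have -> : Dp = Dm + 2 * D0 by rewrite -Duv; ring.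
  by rewrite /c; field.
apply: le_trans (normcD_le _ _) _.
have -> : 2 * normc h * (2 * E * normc h ^+ 2) =
  (E * normc h ^+ 3 + E * normc h ^+ 3) + (E * normc h ^+ 3 + E * normc h ^+ 3).
  by ring.
apply: lerD.
  by apply: le_trans (normcD_le _ _) _; rewrite normcN; exact: lerD.
by apply: le_trans (normcB_le _ _) _; exact: lerD.
Qed.

End ComplexDirections.

(** * Inner products and Wirtinger derivatives *)

Section InnerProduct.
Context {K : numClosedFieldType} {H : normedModType K}.
Variable dot : {dot H for Num.conj}.
Hypothesis dot_norm : forall v : H, `|v| ^+ 2 = dot v v.
Implicit Types (u v x y : H) (a b : K).

Lemma dotC u v : dot u v = (dot v u)^*.
Proof. by rewrite (hermC dot) /= expr0 mul1r. Qed.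

Lemma dotDl u v y : dot (u + v) y = dot u y + dot v y.
Proof. exact: (linearDl dot y u v). Qed.

Lemma dotDr y u v : dot y (u + v) = dot y u + dot y v.
Proof. exact: (linearDr dot y u v). Qed.

Lemma dotZl a u y : dot (a *: u) y = a * dot u y.
Proof. exact: (linearZl_LR dot y a u). Qed.

Lemma dotZr a y u : dot y (a *: u) = a^* * dot y u.
Proof. exact: (linearZr_LR dot y a u). Qed.

Lemma dotNl u y : dot (- u) y = - dot u y.
Proof. by rewrite -scaleN1r dotZl mulN1r. Qed.

Lemma dotNr y u : dot y (- u) = - dot y u.
Proof. by rewrite -scaleN1r dotZr rmorphN1 mulN1r. Qed.

Lemma dotBl u v y : dot (u - v) y = dot u y - dot v y.
Proof. by rewrite dotDl dotNl. Qed.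

Lemma dotBr y u v : dot y (u - v) = dot y u - dot y v.
Proof. by rewrite dotDr dotNr. Qed.

Lemma dot0l y : dot 0 y = 0.
Proof. by rewrite -(scale0r 0) dotZl mul0r. Qed.

Lemma dot0r y : dot y 0 = 0.
Proof. by rewrite -(scale0r 0) dotZr conjC0 mul0r. Qed.

Lemma dot_suml (I : Type) (r : seq I) (P : pred I) (f : I -> H) y :
  dot (\sum_(i <- r | P i) f i) y = \sum_(i <- r | P i) dot (f i) y.
Proof.
by apply: (big_morph (dot^~ y)) => [u v|]; [exact: dotDl|exact: dot0l].
Qed.

Lemma dot_sumr (I : Type) (r : seq I) (P : pred I) (f : I -> H) y :
  dot y (\sum_(i <- r | P i) f i) = \sum_(i <- r | P i) dot y (f i).
Proof.
by apply: (big_morph (dot y)) => [u v|]; [exact: dotDr|exact: dot0r].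
Qed.

Lemma dot_cauchy_schwarz u v : `|dot u v| <= `|u| * `|v|.
Proof.
have [->|v0] := eqVneq v 0; first by rewrite dot0r !normr0 mulr0.
have nv : 0 < `|v| by rewrite normr_gt0.
rewrite -(@ler_pXn2r _ 2)// ?nnegrE ?mulr_ge0//.
have vv : dot v v != 0 by rewrite -dot_norm expf_neq0// gt_eqF.
pose c := dot u v / dot v v; pose p := u - c *: v.
have pv : dot p v = 0 by rewrite dotBl dotZl divfK// subrr.
have : 0 <= `|p| ^+ 2 by rewrite exprn_ge0.
rewrite dot_norm {2}/p dotBr dotZr pv mulr0 subr0 dotBl dotZl (dotC v u).
rewrite /c mulrAC -normCK -!dot_norm subr_ge0 ler_pdivrMr ?exprn_gt0//.
by rewrite exprMn.
Qed.

Lemma cvg_dotl (T : Type) (F : set_system T) (FF : Filter F) (f : T -> H) x y :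
  f t @[t --> F] --> x -> dot (f t) y @[t --> F] --> dot x y.
Proof.
move=> /cvgrPdist_lt fx; apply/cvgrPdist_lt => e e0.
have y1 : 0 < `|y| + 1 by rewrite ltr_wpDl.
have := fx (e / (`|y| + 1)); rewrite divr_gt0// => /(_ isT).
apply: filterS => t; rewrite ltr_pdivlMr// => h.
rewrite -dotBl; apply: le_lt_trans (dot_cauchy_schwarz _ _) _.
by apply: le_lt_trans h; rewrite ler_wpM2l// lerDl.
Qed.

Lemma derivable_dotl {V : normedModType K} (f : V -> H) (z d : V) y :
  derivable f z d -> derivable (fun p => dot (f p) y) z d /\
    'D_d (fun p => dot (f p) y) z = dot ('D_d f z) y.
Proof.
move=> df.
have h : (fun h => h^-1 *: (dot (f (h *: d + z)) y - dot (f z) y)) @ 0^' -->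
    dot ('D_d f z) y.
  rewrite (_ : (fun h => _) =
    (fun h : K => dot (h^-1 *: (f (h *: d + z) - f z)) y)); first exact: cvg_dotl df.
  by apply/funext => h; rewrite dotZl dotBl.
split; last exact: cvg_lim h.
by apply/cvg_ex; exists (dot ('D_d f z) y).
Qed.

End InnerProduct.

Section MatrixLimits.
Context {K : numFieldType} {T : Type} {F : set_system T} {FF : Filter F}.

Lemma cvg_det n (A : T -> 'M[K]_n) (L : 'M[K]_n) :
  (forall i j, A t i j @[t --> F] --> L i j) ->
  \det (A t) @[t --> F] --> \det L.
Proof.
move=> AL; rewrite /determinant.
apply: cvg_big => [|s _]; first exact: add_continuous.
apply: cvgM; first exact: cvg_cst.
by apply: cvg_big => [|i _]; [exact: mul_continuous|exact: AL].
Qed.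

Lemma cvg_invmx n (A : T -> 'M[K]_n) (L : 'M[K]_n) : L \in unitmx ->
  (\forall t \near F, A t \in unitmx) ->
  (forall i j, A t i j @[t --> F] --> L i j) ->
  forall i j, invmx (A t) i j @[t --> F] --> invmx L i j.
Proof.
move=> uL uA AL i j.
suff H : (fun t => (\det (A t))^-1 * \adj (A t) i j) @ F --> invmx L i j.
  apply: cvg_trans H; apply: near_eq_cvg; apply: filterS uA => t ut.
  by rewrite /invmx ut !mxE.
rewrite /invmx uL !mxE; apply: cvgM.
  by apply: cvgV; [rewrite -unitfE -unitmxE|exact: cvg_det].
rewrite (_ : (fun t => _) = (fun t => cofactor (A t) j i)).
  apply: cvgM; first exact: cvg_cst.
  apply: cvg_det => a b.
  rewrite (_ : (fun t => _) = (fun t => A t (lift j a) (lift i b))).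
    by rewrite !mxE; exact: AL.
  by apply/funext => t; rewrite !mxE.
by apply/funext => t; rewrite !mxE.
Qed.

End MatrixLimits.

Section Rays.
Context {K : numClosedFieldType} {V : normedModType K}.
Variable F : set_system K.
Context {FF : ProperFilter F}.
Hypothesis F0 : F `=>` 0^'.
Hypothesis Freal : \forall t \near F, t \is Num.real.
Implicit Types (z v : V) (c t : K).

(* The parameter [t] is real along [F] but lives in [K], so that the limit is
   one in the topology of [K]. *)
Definition ray {W : normedModType K} (f : V -> W) z v (l : W) :=
  t^-1 *: (f (z + t *: v) - f z) @[t --> F] --> l.

Lemma ray_filter_neq0 : \forall t \near F, t != 0.
Proof.
have h : \forall t \near (0 : K)^', t != 0 by exact: nbhs_dnbhs_neq.
exact: F0 h.
Qed.

Lemma ray_filter_cvg0 : t @[t --> F] --> (0 : K).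
Proof. by move=> A A0; apply: F0; apply: filterS A0 => t. Qed.

Lemma near_ray z v (P : set V) : (\forall x \near z, P x) ->
  \forall t \near F, P (z + t *: v).
Proof.
move=> zP; have : z + t *: v @[t --> F] --> z.
  rewrite -[X in _ --> X]addr0; apply: cvgD; first exact: cvg_cst.
  by rewrite -(scale0r v); apply: cvgZl; exact: ray_filter_cvg0.
exact.
Qed.

Section Vector.
Context {W : normedModType K}.
Implicit Types (f g : V -> W) (l : W).

Lemma ray_derive f z v c : c != 0 -> derivable f z v ->
  ray f z (c *: v) (c *: 'D_v f z).
Proof.
move=> c0 df; rewrite /ray.
have tc : t * c @[t --> F] --> 0^'.
  move=> A /nbhs_normP[d /= d0 dA].
  have h : \forall t \near F, `|t| < d / `|c|.
    have dc : 0 < d / `|c| by rewrite divr_gt0// normr_gt0.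
    have /cvgrPdist_lt/(_ _ dc) := ray_filter_cvg0.
    by apply: filterS => t; rewrite sub0r normrN.
  change (\forall t \near F, A (t * c)); near=> t; apply: dA.
    rewrite /ball_/= sub0r normrN. rewrite normrM -ltr_pdivlMr ?normr_gt0//.
    by near: t.
  by rewrite mulf_neq0//; near: t; exact: ray_filter_neq0.
rewrite (_ : (fun t => _) = (fun t => c *: ((t * c)^-1 *: (f ((t * c) *: v + z) - f z)))).
  apply: cvgZr; exact: (cvg_comp _ _ tc df).
apply/funext => t; rewrite !scalerA invfM.
by rewrite mulrCA divff// mulr1 (addrC z).
Unshelve. all: by end_near. Qed.

Lemma ray_cvg f z v l : ray f z v l -> f (z + t *: v) @[t --> F] --> f z.
Proof.
move=> fl.
have : t *: (t^-1 *: (f (z + t *: v) - f z)) + f z @[t --> F] --> 0 *: l + f z.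
  apply: cvgD; last exact: cvg_cst.
  by apply: cvgZ => //; exact: ray_filter_cvg0.
rewrite scale0r add0r; apply: cvg_trans; apply: near_eq_cvg.
near=> t; have t0 : t != 0 by near: t; exact: ray_filter_neq0.
by rewrite scalerA divff// scale1r subrK.
Unshelve. all: by end_near. Qed.

Lemma ray_near f g z v l : (\forall x \near z, f x = g x) ->
  ray f z v l -> ray g z v l.
Proof.
move=> fg; have fgz := nbhs_singleton fg.
apply: cvg_trans; apply: near_eq_cvg.
have := near_ray v fg; apply: filterS => t /= ->.
by rewrite fgz.
Qed.

Lemma ray_sum (I : Type) (r : seq I) (P : pred I) (f : I -> V -> W) z v
    (l : I -> W) : (forall i, P i -> ray (f i) z v (l i)) ->
  ray (fun x => \sum_(i <- r | P i) f i x) z v (\sum_(i <- r | P i) l i).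
Proof.
move=> fl; rewrite /ray.
rewrite (_ : (fun t => _) = (fun t => \sum_(i <- r | P i)
  t^-1 *: (f i (z + t *: v) - f i z))).
  by apply: cvg_big => //; exact: add_continuous.
by apply/funext => t; rewrite -sumrB scaler_sumr.
Qed.

End Vector.

Lemma rayM (f g : V -> K) z v a b : ray f z v a -> ray g z v b ->
  ray (fun x => f x * g x) z v (a * g z + f z * b).
Proof.
move=> fa gb; rewrite /ray.
rewrite (_ : (fun t => _) = (fun t => t^-1 *: (f (z + t *: v) - f z) * g z +
   f (z + t *: v) * (t^-1 *: (g (z + t *: v) - g z)))); last first.
  by apply/funext => t; rewrite /GRing.scale/=; ring.
apply: cvgD; first by apply: cvgM => //; exact: cvg_cst.
by apply: cvgM => //; exact: ray_cvg fa.
Qed.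

Lemma ray_invmx n (h : V -> 'M[K]_n) z v (A : 'M[K]_n) : h z = 1%:M ->
  (\forall x \near z, h x \in unitmx) ->
  (forall a b, ray (fun x => h x a b) z v (A a b)) ->
  forall a b, ray (fun x => invmx (h x) a b) z v (- A a b).
Proof.
move=> hz hu hA a b; rewrite /ray.
have kcvg (c d : 'I_n) : invmx (h (z + t *: v)) c d @[t --> F] --> (1%:M : 'M[K]_n) c d.
  rewrite -[1%:M]invmx1 -hz; apply: cvg_invmx; first by rewrite hz unitmx1.
    exact: (near_ray v hu).
  by move=> i j; exact: (ray_cvg (hA i j)).
suff H : (fun t => - \sum_c invmx (h (z + t *: v)) a c *
    (t^-1 *: (h (z + t *: v) c b - h z c b))) @ F --> - A a b.
  apply: cvg_trans H; apply: near_eq_cvg.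
  have := near_ray v hu; apply: filterS => t /= ut.
  rewrite hz invmx1.
  have -> : invmx (h (z + t *: v)) a b - (1%:M : 'M[K]_n) a b =
      - (invmx (h (z + t *: v)) *m (h (z + t *: v) - 1%:M)) a b.
    by rewrite mulmxBr mulVmx// mulmx1 !mxE opprB.
  rewrite mxE scalerN scaler_sumr; congr (- _); apply: eq_bigr => c _.
  by rewrite scalerAr !mxE.
rewrite [X in _ --> - X](_ : _ = \sum_c (1%:M : 'M[K]_n) a c * A c b).
  apply: cvgN; apply: cvg_big => [|c _]; first exact: add_continuous.
  by apply: cvgM; [exact: kcvg|exact: hA].
by rewrite -[in LHS](mul1mx A) mxE.
Qed.

Section RayDot.
Context {H : normedModType K}.
Variable dot : {dot H for Num.conj}.
Hypothesis dot_norm : forall v : H, `|v| ^+ 2 = dot v v.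

Lemma ray_dot (X Y : V -> H) z v (B a : K) (Y' : H) :
  (\forall t \near F, `|X (z + t *: v)| <= B) ->
  ray (fun x => dot (X x) (Y z)) z v a ->
  dot (X (z + t *: v)) Y' @[t --> F] --> dot (X z) Y' ->
  ray Y z v Y' ->
  ray (fun x => dot (X x) (Y x)) z v (a + dot (X z) Y').
Proof.
move=> XB Xa XY' YY'; rewrite /ray.
pose q t := t^-1 *: (Y (z + t *: v) - Y z).
suff h : (fun t => t^-1 *: (dot (X (z + t *: v)) (Y z) - dot (X z) (Y z)) +
    (dot (X (z + t *: v)) Y' + dot (X (z + t *: v)) (q t - Y'))) @ F -->
    a + dot (X z) Y'.
  apply: cvg_trans h; apply: near_eq_cvg; near=> t.
  have tr : t^-1 \is Num.real by rewrite realV; near: t; exact: Freal.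
  rewrite -dotDr (addrC Y') subrK /q dotZr (CrealP tr) dotBr.
  by rewrite /GRing.scale/=; ring.
apply: cvgD => //; rewrite -[X in _ --> X]addr0; apply: cvgD => //.
have B0 : 0 <= B.
  have /filter_ex[t] := XB; exact: le_trans (normr_ge0 _).
apply/cvgrPdist_lt => e e0; move/cvgrPdist_lt : YY' => YY'.
have B1 : 0 < B + 1 by rewrite ltr_wpDl.
near=> t; rewrite sub0r normrN.
apply: le_lt_trans (dot_cauchy_schwarz dot_norm _ _) _.
have h1 : `|X (z + t *: v)| <= B by near: t.
have h2 : `|Y' - q t| < e / (B + 1) by near: t; apply: YY'; exact: divr_gt0.
rewrite distrC; apply: (@le_lt_trans _ _ ((B + 1) * `|Y' - q t|)).
  by rewrite ler_wpM2r// (le_trans h1)// lerDl.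
by rewrite mulrC -ltr_pdivlMr.
Unshelve. all: by end_near. Qed.

End RayDot.

End Rays.

Section HilbertHolomorphic.
Context {R : realType} {V H : normedModType R[i]}.
Local Notation C := (R[i]^o).
Variable dot : {dot H for Num.conj}.
Hypothesis dot_norm : forall v : H, `|v| ^+ 2 = dot v v.
Variables (gamma : V -> H) (w : V).
Hypothesis gamma_diff : \forall z \near w, differentiable gamma z.

Lemma locally_bounded : exists r M : R, [/\ 0 < r, 0 <= M &
  forall z, `|z - w| < r%:C -> differentiable gamma z /\ `|gamma z| <= M%:C].
Proof.
have g1 : 0 < `|gamma w| + 1 by rewrite ltr_wpDl.
have [M M0 ME] := gt0_real_complex g1.
have : \forall z \near w, differentiable gamma z /\ `|gamma z| <= M%:C.
  near=> z; split; first by near: z.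
  rewrite -ME -lerBlDl; apply: le_trans (lerB_dist _ _) _.
  rewrite distrC; near: z.
  have /differentiable_continuous/cvgrPdist_le/(_ 1 ltr01) := nbhs_singleton gamma_diff.
  exact.
move=> /nbhs_normP[r r0 Hr]; have [s s0 sE] := gt0_real_complex r0.
exists s, M; split=> //; first exact: ltW.
by move=> z zw; apply: Hr; rewrite /ball_ /= distrC sE.
Unshelve. all: by end_near. Qed.

Lemma dot_gamma_bounded r (M : R) y : 0 <= M ->
  (forall z, `|z - w| < r%:C -> differentiable gamma z /\ `|gamma z| <= M%:C) ->
  exists Y : R, [/\ 0 <= Y, `|y| = Y%:C & forall z, `|z - w| < r%:C ->
    (forall x, derivable (fun p => dot (gamma p) y : C) z x) /\
    normc (dot (gamma z) y) <= M * Y].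
Proof.
move=> M0 Hr.
have [Y YE] : exists Y : R, `|y| = Y%:C.
  by have /complex_realP[Y ->] := normr_real y; exists Y.
have Y0 : 0 <= Y by rewrite -ler0c -YE.
exists Y; split=> // z zw; have [dg bg] := Hr z zw; split.
  move=> x; exact: (derivable_dotl dot_norm y (@diff_derivable _ _ _ _ _ x dg)).1.
rewrite -lecR (_ : (M * Y)%:C = M%:C * `|y|); last by rewrite YE -rmorphM.
apply: le_trans (dot_cauchy_schwarz dot_norm _ _) _.
by rewrite ler_wpM2r.
Qed.

(* Cauchy's estimate for the scalar function [dot gamma y], with
   [y := 'D_v gamma z] itself. *)
Lemma derive_bounded_near v :
  exists B : R[i], \forall z \near w, `|'D_v gamma z| <= B.
Proof.
have [r [M [r0 M0 Hr]]] := locally_bounded.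
have v1 : 0 < `|v| + 1 by rewrite ltr_wpDl.
have [N N0 NE] := gt0_real_complex v1.
pose s := r / (4 * N).
have s0 : 0 < s by rewrite divr_gt0// mulr_gt0.
exists (4 * M / s)%:C.
near=> z.
have zr : `|z - w| < (r / 2)%:C.
  rewrite distrC; near: z; apply: cvgr_dist_lt; first exact: cvg_id.
  by rewrite ltcR divr_gt0.
set y := 'D_v gamma z.
have [Y [Y0 YE Hy]] := dot_gamma_bounded y M0 Hr.
have [+ _] : normc ('D_v (fun p => dot (gamma p) y : C) z) <= 4 * (M * Y) / s /\
  exists c, forall t, normc t <= s / 2 ->
    normc (dot (gamma (z + t *: v)) y - (dot (gamma z) y +
      'D_v (fun p => dot (gamma p) y : C) z * t + c * t ^+ 2)) <=
    16 * (M * Y) / s ^+ 3 * normc t ^+ 3.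
  apply: (@taylor_line R V (fun p => dot (gamma p) y)) => // t ht.
  have [|h1 h2] := Hy (z + t *: v); last by split.
  rewrite addrAC; apply: le_lt_trans (ler_normD _ _) _.
  rewrite (_ : r%:C = (r / 2)%:C + (r / 2)%:C); last first.
    by rewrite -rmorphD; congr (_%:C); field.
  apply: ltr_leD => //; rewrite normrZ.
  apply: (@le_trans _ _ ((2 * s)%:C * (`|v| + 1))).
    apply: ler_pM => //; first by change (is_true ((normc t)%:C <= (2 * s)%:C)); rewrite lecR.
    by rewrite lerDl.
  rewrite NE -rmorphM lecR /s le_eqVlt; apply/orP; left; apply/eqP.
  by field; rewrite gt_eqF.
have zr' : `|z - w| < r%:C.
  by apply: lt_trans zr _; rewrite ltcR; lra.
rewrite (derivable_dotl dot_norm y (@diff_derivable _ _ _ _ _ v (Hr z zr').1)).2.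
rewrite -/y -dot_norm YE -rmorphXn normc_real ger0_norm ?sqr_ge0// lecR.
move: Y0; rewrite le_eqVlt => /predU1P[<- _|Y0 h].
  by apply: divr_ge0; [exact: mulr_ge0|exact: ltW].
rewrite -(ler_pM2r Y0) -expr2; apply: le_trans h _.
by rewrite le_eqVlt; apply/orP; left; apply/eqP; ring.
Unshelve. all: by end_near. Qed.

Lemma derive_weakly_derivable u v y :
  derivable (fun p => dot ('D_v gamma p) y : C) w u.
Proof.
have [r [M [r0 M0 Hr]]] := locally_bounded.
have [Y [Y0 YE Hy]] := dot_gamma_bounded y M0 Hr.
pose f p := dot (gamma p) y.
have Df z x : `|z - w| < r%:C -> 'D_x (f : V -> C) z = dot ('D_x gamma z) y.
  move=> zw.
  exact: (derivable_dotl dot_norm y (@diff_derivable _ _ _ _ _ x (Hr z zw).1)).2.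
have ww : `|w - w| < r%:C by rewrite subrr normr0 ltcR.
have dgw := (Hr w ww).1.
have : derivable ('D_v (f : V -> C)) w u.
  apply: second_derivable r0 Hy _.
  rewrite !Df// !deriveE// linearD linearB /= dotDl dotBl.
  ring.
apply: (@near_eq_derivable R[i] V C).
apply/(@nbhs_normP _ V); exists r%:C; first by rewrite /= ltcR.
by move=> z; rewrite /ball_ /= distrC => zw; exact: Df.
Qed.

End HilbertHolomorphic.

Section RealRays.
Context {R : realType} {m : nat}.
Local Notation V := 'rV[R[i]]_m.
Local Notation C := (R[i]^o).
Implicit Types (g : V -> R[i]) (z v : V) (k : 'I_m).

Definition dnbhs0_real : set_system R[i] := t%:C @[t --> (0 : R)^'].

Lemma dnbhs0_real_proper : ProperFilter dnbhs0_real.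
Proof. exact: fmap_proper_filter. Qed.
#[local] Existing Instance dnbhs0_real_proper.

Lemma dnbhs0_real_dnbhs : dnbhs0_real `=>` (0 : R[i])^'.
Proof.
move=> A /(@nbhs_normP _ C)[d d0 dA]; have [e e0 eE] := gt0_real_complex d0.
change (\forall t \near (0 : R)^', A t%:C); near=> t; apply: dA.
  rewrite eE; change (is_true ((normc (0 - t%:C))%:C < e%:C)).
  rewrite sub0r normcN normc_real ltcR.
  by near: t; apply: dnbhs0_lt.
change (is_true (t%:C != 0)); rewrite -normc_eq0 normc_real normr_eq0.
by near: t; exact: nbhs_dnbhs_neq.
Unshelve. all: by end_near. Qed.

Lemma dnbhs0_real_real : \forall t \near dnbhs0_real, t \is Num.real.
Proof.
change (\forall t \near (0 : R)^', t%:C \is Num.real).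
by near=> t; apply/complex_realP; exists t.
Unshelve. all: by end_near. Qed.

Lemma ray_real_dir_deriv g z v l : ray dnbhs0_real (g : V -> C) z v l ->
  real_dir_deriv g z v = l.
Proof.
move=> gl; rewrite /real_dir_deriv.
have part (p : R[i] -> R) : continuous p -> (forall a b, p (a - b) = p a - p b) ->
    (forall (t : R) a, p (t%:C * a) = t * p a) ->
    derive1 (fun t : R => p (g (z + t%:C *: v))) 0 = p l.
  move=> cp pB pZ; rewrite /derive1; apply: cvg_lim => //.
  rewrite (_ : (fun h => _) = p \o (fun t : R[i] => t^-1 *: (g (z + t *: v) - g z : C))
     \o (fun t : R => t%:C)).
    exact: (cvg_comp _ _ gl (cp l)).
  apply/funext => h /=; rewrite addr0 scale0r addr0 /GRing.scale/=.
  by rewrite -fmorphV pZ pB.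
rewrite !part.
- by clear; case: l.
- exact: continuous_Im.
- by move=> a b; rewrite raddfB.
- by move=> t [a b]; simpc.
- exact: continuous_Re.
- by move=> a b; rewrite raddfB.
- by move=> t [a b]; simpc.
Qed.

(* [a] and [b] are the values at [z] of the Wirtinger derivatives of [g] with
   respect to [z_k] and its conjugate. *)
Definition wderiv k g z (a b : R[i]) :=
  ray dnbhs0_real (g : V -> C) z 'e_k (a + b) /\
  ray dnbhs0_real (g : V -> C) z ('i *: 'e_k) ('i * a - 'i * b).

Lemma wderiv_wirtinger k g z a b : wderiv k g z a b ->
  wirtinger k g z = a /\ wirtinger_bar k g z = b.
Proof.
move=> [/ray_real_dir_deriv h1 /ray_real_dir_deriv h2].
have ii : 'i * 'i = -1 :> R[i] by rewrite -expr2 sqrCi.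
have e : 'i * ('i * a - 'i * b) = b - a by rewrite -mulrBr mulrA ii mulN1r opprB.
by rewrite /wirtinger /wirtinger_bar h1 h2 e; split; field.
Qed.

Lemma wderiv_near k g1 g2 z a b : (\forall x \near z, g1 x = g2 x) ->
  wderiv k g1 z a b -> wderiv k g2 z a b.
Proof.
by move=> g12 [h1 h2]; split; [move: h1|move: h2];
  apply: (@ray_near _ _ _ _ dnbhs0_real_dnbhs C).
Qed.

Lemma wderiv_sum k (I : Type) (r : seq I) (g : I -> V -> R[i]) z (a b : I -> R[i]) :
  (forall i, wderiv k (g i) z (a i) (b i)) ->
  wderiv k (fun x => \sum_(i <- r) g i x) z (\sum_(i <- r) a i) (\sum_(i <- r) b i).
Proof.
move=> h; split.
  rewrite -big_split/=.
  by apply: (@ray_sum _ _ dnbhs0_real _ C) => i _; exact: (h i).1.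
rewrite !mulr_sumr -sumrB.
by apply: (@ray_sum _ _ dnbhs0_real _ C) => i _; exact: (h i).2.
Qed.

Lemma wderivM k g1 g2 z a1 b1 a2 b2 : wderiv k g1 z a1 b1 -> wderiv k g2 z a2 b2 ->
  wderiv k (fun x => g1 x * g2 x) z (a1 * g2 z + g1 z * a2) (b1 * g2 z + g1 z * b2).
Proof.
move=> [h1 h1'] [h2 h2']; split.
  have -> : a1 * g2 z + g1 z * a2 + (b1 * g2 z + g1 z * b2) =
    (a1 + b1) * g2 z + g1 z * (a2 + b2) by ring.
  exact: (@rayM R[i] V dnbhs0_real dnbhs0_real_proper dnbhs0_real_dnbhs g1 g2 z _ _ _ h1 h2).
have -> : 'i * (a1 * g2 z + g1 z * a2) - 'i * (b1 * g2 z + g1 z * b2) =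
  ('i * a1 - 'i * b1) * g2 z + g1 z * ('i * a2 - 'i * b2) by ring.
exact: (@rayM R[i] V dnbhs0_real dnbhs0_real_proper dnbhs0_real_dnbhs g1 g2 z _ _ _ h1' h2').
Qed.

Lemma wderiv_invmx k n (h : V -> 'M[R[i]]_n) z (A B : 'M[R[i]]_n) : h z = 1%:M ->
  (\forall x \near z, h x \in unitmx) ->
  (forall a b, wderiv k (fun x => h x a b) z (A a b) (B a b)) ->
  forall a b, wderiv k (fun x => invmx (h x) a b) z (- A a b) (- B a b).
Proof.
move=> hz hu hAB a b; split.
  rewrite -opprD (_ : A a b + B a b = (A + B) a b); last by rewrite mxE.
  apply: (@ray_invmx R[i] V dnbhs0_real dnbhs0_real_proper dnbhs0_real_dnbhs) => // c d; rewrite mxE.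
  exact: (hAB c d).1.
rewrite !mulrN -opprD (_ : 'i * A a b - 'i * B a b = ('i *: (A - B)) a b); last first.
  by rewrite !mxE; ring.
apply: (@ray_invmx R[i] V dnbhs0_real dnbhs0_real_proper dnbhs0_real_dnbhs) => // c d.
by rewrite !mxE mulrBr; exact: (hAB c d).2.
Qed.

Section WirtingerDot.
Context {H : normedModType R[i]}.
Variable dot : {dot H for Num.conj}.
Hypothesis dot_norm : forall v : H, `|v| ^+ 2 = dot v v.

Lemma wderiv_dot (X Y : V -> H) k z (B : R[i]) :
  (\forall x \near z, `|X x| <= B) ->
  (forall y, derivable (fun x => dot (X x) y : C) z 'e_k) ->
  derivable Y z 'e_k ->
  wderiv k (fun x => dot (X x) (Y x)) z
    ('D_('e_k) (fun x => dot (X x) (Y z) : C) z) (dot (X z) ('D_('e_k) Y z)).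
Proof.
move=> XB Xd Yd.
set a := 'D_('e_k) _ z; set Y' := 'D_('e_k) Y z.
have main (c : R[i]) : c != 0 -> ray dnbhs0_real (fun x => dot (X x) (Y x) : C) z (c *: 'e_k)
    (c * a + c^* * dot (X z) Y').
  move=> c0; rewrite -(dotZr dot).
  apply: (ray_dot dnbhs0_real_real dot_norm (B := B)).
  - exact: (near_ray dnbhs0_real_dnbhs (c *: 'e_k) XB).
  - exact: (@ray_derive R[i] V dnbhs0_real dnbhs0_real_proper dnbhs0_real_dnbhs C
      _ z _ c c0 (Xd (Y z))).
  - have h := @ray_derive R[i] V dnbhs0_real dnbhs0_real_proper dnbhs0_real_dnbhs C
      _ z _ c c0 (Xd (c *: Y')).
    exact: (ray_cvg dnbhs0_real_dnbhs h).
  - exact: (ray_derive dnbhs0_real_dnbhs c0 Yd).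
split.
  have := main 1 (oner_neq0 _).
  by rewrite scale1r conjC1 !mul1r.
have := main 'i (neq0Ci _).
by rewrite conjCi mulNr.
Qed.

End WirtingerDot.
End RealRays.

(** * The curvature at a point where the frame is orthonormal *)

Section CurvatureAtOrthonormalFrame.
Context {R : realType} {H : completeNormedModType R[i]} {m n : nat}.
Local Notation V := 'rV[R[i]]_m.
Local Notation C := (R[i]^o).
Variable dot : {dot H for Num.conj}.
Hypothesis dot_norm : forall v : H, `|v| ^+ 2 = dot v v.
Variables (gamma : 'I_n -> V -> H) (U : set V) (w : V).
Hypotheses (U_open : open U) (U_w : U w).
Hypothesis gamma_diff : forall j z, U z -> differentiable (gamma j) z.

Local Notation D k j := (fun z : V => 'D_('e_k) (gamma j) z).
Local Notation G := (gram dot gamma).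

Lemma near_in z : U z -> \forall x \near z, U x.
Proof. by move=> Uz; exact: open_nbhs_nbhs. Qed.

Lemma wderiv_gram k p q z : U z -> wderiv k (fun x => G x p q) z
  (dot (D k q z) (gamma p z)) (dot (gamma q z) (D k p z)).
Proof.
move=> Uz.
have dq := @diff_derivable _ _ _ _ _ 'e_k (gamma_diff q Uz).
have dp := @diff_derivable _ _ _ _ _ 'e_k (gamma_diff p Uz).
have [B HB] : exists B : R[i], \forall x \near z, `|gamma q x| <= B.
  exists (`|gamma q z| + 1); near=> x.
  rewrite -lerBlDl; apply: le_trans (lerB_dist _ _) _.
  rewrite distrC; near: x.
  by have /differentiable_continuous/cvgrPdist_le/(_ 1 ltr01) := gamma_diff q Uz.
rewrite -(derivable_dotl dot_norm (gamma p z) dq).2.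
rewrite (_ : (fun x => G x p q) = (fun x => dot (gamma q x) (gamma p x))).
  apply: (wderiv_dot dot_norm HB _ dp) => y.
  exact: (derivable_dotl dot_norm y dq).1.
by apply/funext => x; rewrite mxE.
Unshelve. all: by end_near. Qed.

Lemma wirtinger_gram i x : U x ->
  wirtinger_mx i G x = \matrix_(a, b) dot (D i b x) (gamma a x).
Proof.
move=> Ux; apply/matrixP => a b; rewrite !mxE.
exact: (wderiv_wirtinger (wderiv_gram i a b Ux)).1.
Qed.

Lemma wderiv_wirtinger_gram i j a b : exists c,
  wderiv j (fun x => wirtinger_mx i G x a b) w c (dot (D i b w) (D j a w)).
Proof.
have gd q : \forall x \near w, differentiable (gamma q) x.
  by apply: filterS (near_in U_w) => x; exact: gamma_diff.
have [B HB] := derive_bounded_near dot_norm (gd b) 'e_i.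
have da := @diff_derivable _ _ _ _ _ 'e_j (gamma_diff a U_w).
eexists; apply: wderiv_near; last first.
  apply: (wderiv_dot dot_norm HB _ da) => y.
  exact: (derive_weakly_derivable dot_norm (gd b)).
apply: filterS (near_in U_w) => x Ux.
by rewrite wirtinger_gram// mxE.
Qed.

Lemma curvature_coef_orthonormal i j : G w = 1%:M ->
  (forall z, U z -> G z \in unitmx) ->
  curvature_coef dot gamma i j w = - \matrix_(a, b)
    (dot (D i b w) (D j a w) -
     \sum_c dot (gamma c w) (D j a w) * dot (D i b w) (gamma c w)).
Proof.
move=> Gw Gu; rewrite /curvature_coef; congr (- _).
apply/matrixP => a b; rewrite !mxE.
have hinv c : wderiv j (fun x => invmx (G x) a c) w
    (- dot (D j c w) (gamma a w)) (- dot (gamma c w) (D j a w)).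
  have -> : - dot (D j c w) (gamma a w) =
    - (\matrix_(p, q) dot (D j q w) (gamma p w)) a c by rewrite mxE.
  have -> : - dot (gamma c w) (D j a w) =
    - (\matrix_(p, q) dot (gamma q w) (D j p w)) a c by rewrite mxE.
  apply: wderiv_invmx Gw _ _ _ _.
    by apply: filterS (near_in U_w) => x; exact: Gu.
  by move=> p q; rewrite !mxE; exact: wderiv_gram.
pose K c := projT1 (cid (wderiv_wirtinger_gram i j c b)).
have hK c : wderiv j (fun x => wirtinger_mx i G x c b) w (K c)
    (dot (D i b w) (D j c w)) := projT2 (cid (wderiv_wirtinger_gram i j c b)).
have := wderiv_sum (index_enum _) (fun c => wderivM (hinv c) (hK c)).
move=> /wderiv_wirtinger[_].
rewrite (_ : (fun x => _) = (fun x => (invmx (G x) *m wirtinger_mx i G x) a b)).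
  move=> ->; rewrite big_split/= addrC; congr (_ + _).
    rewrite Gw invmx1 (bigD1 a)//= mxE eqxx mul1r big1 ?addr0// => c ca.
    by rewrite mxE eq_sym (negPf ca) mul0r.
  rewrite -sumrN; apply: eq_bigr => c _.
  by rewrite wirtinger_gram// mxE mulNr.
by apply/funext => x; rewrite mxE.
Qed.

End CurvatureAtOrthonormalFrame.

(** * The local operators *)

Section OrthonormalizationMatrix.
Context {K : numClosedFieldType} {H : normedModType K}.
Variable dot : {dot H for Num.conj}.
Hypothesis dot_norm : forall v : H, `|v| ^+ 2 = dot v v.

Lemma dot_sum2 N (eta : 'I_N -> H) (a b : 'I_N -> K) :
  dot (\sum_t a t *: eta t) (\sum_s b s *: eta s) =
  \sum_s \sum_t (b s)^* * dot (eta t) (eta s) * a t.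
Proof.
rewrite dot_sumr; apply: eq_bigr => s _; rewrite dotZr dot_suml mulr_sumr.
by apply: eq_bigr => t _; rewrite dotZl mulrCA mulrC -!mulrA.
Qed.

Lemma gram_factorization N (eta : 'I_N -> H) :
  (forall c : 'I_N -> K, \sum_t c t *: eta t = 0 -> forall t, c t = 0) ->
  exists2 A : 'M[K]_N, A \in unitmx &
    (map_mx Num.conj A)^T *m A = \matrix_(s, t) dot (eta t) (eta s).
Proof.
move=> free_eta; set G := \matrix_(s, t) _.
have GH : map_mx Num.conj G^T = G.
  by apply/matrixP => s t; rewrite !mxE -dotC.
have /orthomx_spectralP GE : G \is normalmx by apply/normalmxP; rewrite GH.
pose P := spectralmx G; pose d := spectral_diag G.
have Pu : P \in unitmx by exact: spectral_unit.
have PV : invmx P = map_mx Num.conj P^T by apply: invmx_unitary; exact: spectral_unitarymx.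
have d_gt0 i : 0 < d 0 i.
  have -> : d 0 i = (P *m G *m invmx P) i i.
    by rewrite GE -/P -/d !mulmxA mulmxV// mul1mx mulmxK// mxE eqxx mulr1n.
  pose u := \sum_t (P i t)^* *: eta t.
  have -> : (P *m G *m invmx P) i i = dot u u.
    rewrite /u dot_sum2 exchange_big PV mxE; apply: eq_bigr => t _.
    rewrite !mxE mulr_suml; apply: eq_bigr => s _.
    by rewrite !mxE conjCK.
  rewrite -dot_norm exprn_gt0// normr_gt0; apply/eqP => /free_eta u0.
  have : row i P *m invmx P = 0.
    rewrite (_ : row i P = 0) ?mul0mx//; apply/rowP => t; rewrite !mxE.
    by apply/eqP; rewrite -conjC_eq0 u0.
  rewrite -row_mul mulmxV// => /rowP/(_ i)/eqP.
  by rewrite !mxE eqxx oner_eq0.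
exists (diag_mx (map_mx sqrtC d) *m P).
  rewrite unitmx_mul Pu andbT unitmxE det_diag unitfE.
  by apply/prodf_neq0 => i _; rewrite mxE sqrtC_eq0 gt_eqF.
rewrite -/d map_mxM trmx_mul [in RHS]GE -/P -/d PV map_trmx -!mulmxA; congr (_ *m _).
rewrite !mulmxA; congr (_ *m _).
rewrite map_diag_mx tr_diag_mx mulmx_diag; congr diag_mx.
apply/rowP => i; rewrite !mxE /=.
have -> : (sqrtC (d 0 i))^* = sqrtC (d 0 i).
  by apply/CrealP; rewrite ger0_real// sqrtC_ge0 ltW.
by rewrite -expr2 sqrtCK.
Qed.

End OrthonormalizationMatrix.

Section SpanOfFamily.
Context {R : realType} {H : lmodType R[i]}.

Lemma lin_span_rangeP N (e : 'I_N -> H) v :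
  lin_span (range e) v <-> exists c : 'I_N -> R[i], v = \sum_k c k *: e k.
Proof.
split=> [[p [u [c [ue ->]]]]|[c ->]]; last first.
  by exists N, e, c; split=> // k; exists k.
elim/big_ind: _ => [|x y [a ->] [b ->]|i _].
- by exists (fun=> 0); rewrite big1// => k _; rewrite scale0r.
- exists (fun k => a k + b k); rewrite -big_split/=.
  by apply: eq_bigr => k _; rewrite scalerDl.
- have [k _ <-] := ue i; exists (fun j => c i * (j == k)%:R).
  rewrite (bigD1 k)//= eqxx mulr1 big1 ?addr0// => j /negPf ->.
  by rewrite mulr0 scale0r.
Qed.

End SpanOfFamily.

Section FrameDerivatives.
Context {R : realType} {H : completeNormedModType R[i]} {m n : nat}.
Local Notation V := 'rV[R[i]]_m.
Variables (T : 'I_m -> {linear H -> H}) (gamma : V -> H) (U : set V) (w : V).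
Hypothesis T_cont : forall k, continuous (T k).
Hypotheses (U_open : open U) (U_w : U w).
Hypothesis gamma_diff : differentiable gamma w.
Hypothesis gamma_ker : forall z, U z -> joint_ker T z (gamma z).

Lemma shift_op_derive k l :
  shift_op T w l ('D_('e_k) gamma w) = (k == l)%:R *: gamma w.
Proof.
have dg := @diff_derivable _ _ _ _ _ 'e_k gamma_diff.
pose q (h : R[i]) := h^-1 *: (gamma (h *: 'e_k + w) - gamma w).
have q_cvg : q h @[h --> 0^'] --> 'D_('e_k) gamma w by exact: dg.
have Tq : T l (q h) @[h --> 0^'] --> T l ('D_('e_k) gamma w).
  by apply: (cvg_comp _ _ q_cvg); exact: T_cont.
have line : h *: 'e_k + w @[h --> (0 : R[i])^'] --> w.
  rewrite -[X in _ --> X]add0r -{1}(scale0r ('e_k : V)); apply: cvgD; last exact: cvg_cst.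
  by apply: cvgZl; exact: (@nbhs_dnbhs _ (0 : R[i]^o)).
have gline : gamma (h *: 'e_k + w) @[h --> (0 : R[i])^'] --> gamma w.
  apply: (cvg_comp _ _ line).
  exact: (differentiable_continuous gamma_diff).
have Tq' : T l (q h) @[h --> 0^'] -->
    w 0 l *: 'D_('e_k) gamma w + (k == l)%:R *: gamma w.
  suff : (fun h : R[i] => w 0 l *: q h + (k == l)%:R *: gamma (h *: 'e_k + w)) @ 0^' -->
      w 0 l *: 'D_('e_k) gamma w + (k == l)%:R *: gamma w.
    apply: cvg_trans; apply: near_eq_cvg; near=> h.
    have h0 : h != 0 by near: h; exact: (@nbhs_dnbhs_neq _ (0 : R[i]^o)).
    have Uh : U (h *: 'e_k + w).
      by near: h; apply: line; exact: open_nbhs_nbhs.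
    have := gamma_ker Uh l; rewrite /shift_op => /eqP; rewrite subr_eq0 => /eqP e1.
    have := gamma_ker U_w l; rewrite /shift_op => /eqP; rewrite subr_eq0 => /eqP e2.
    have -> : T l (q h) = h^-1 *: (T l (gamma (h *: 'e_k + w)) - T l (gamma w)).
      by rewrite [LHS]linearZ /= linearB.
    rewrite /q e1 e2 !mxE eqxx /= eq_sym.
    set d : R[i] := (_ == _)%:R; set g := gamma _.
    have -> : (h * d + w 0 l) *: g - w 0 l *: gamma w =
        h *: (d *: g) + w 0 l *: (g - gamma w).
      by rewrite scalerDl scalerA scalerBr addrA.
    rewrite [RHS]scalerDr (scalerA h^-1 h) mulVf// scale1r addrC; congr (_ + _).
    by rewrite !scalerA mulrC.
  apply: cvgD; first exact: cvgZr.
  exact: cvgZr.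
rewrite /shift_op (cvg_unique (@norm_hausdorff _ H) Tq Tq').
by rewrite addrAC subrr add0r.
Unshelve. all: by end_near. Qed.

End FrameDerivatives.

Section LocalOperators.
Context {R : realType} {H : completeNormedModType R[i]} {m n : nat}.
Variables (T : 'I_m -> {linear H -> H}) (dot : {dot H for Num.conj}).
Hypothesis dot_norm : forall v : H, `|v| ^+ 2 = dot v v.
Variables (w : 'rV[R[i]]_m) (g : 'I_n -> H) (dg : 'I_m -> 'I_n -> H).
Hypothesis g_basis : is_basis g (joint_ker T w).
Hypothesis g_orth : forall i j, dot (g i) (g j) = (i == j)%:R.
Hypothesis dg_shift : forall k l j,
  shift_op T w l (dg k j) = (k == l)%:R *: g j.

Local Notation N := (\sum_(i < m) n)%N.
Local Notation s1 s := (@tagnat.sig1 m (fun=> n) s).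
Local Notation s2 s := (@tagnat.sig2 m (fun=> n) s : 'I_n).
Local Notation rk l k := (@tagnat.Rank m (fun=> n) l k).

Lemma shift_op_sum l (I : finType) (c : I -> R[i]) (u : I -> H) :
  shift_op T w l (\sum_i c i *: u i) = \sum_i c i *: shift_op T w l (u i).
Proof.
rewrite /shift_op linear_sum scaler_sumr -sumrB; apply: eq_bigr => i _.
by rewrite linearZ scalerBr /= !scalerA mulrC.
Qed.

Lemma shift_op_add l u v :
  shift_op T w l (u + v) = shift_op T w l u + shift_op T w l v.
Proof. by rewrite /shift_op linearD scalerDr opprD addrACA. Qed.

Lemma shift_op0 l : shift_op T w l 0 = 0.
Proof. by rewrite /shift_op linear0 scaler0 subr0. Qed.

Lemma shift_op_opp l u : shift_op T w l (- u) = - shift_op T w l u.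
Proof. by rewrite /shift_op linearN scalerN opprB opprK addrC. Qed.

Lemma g_ker l j : shift_op T w l (g j) = 0.
Proof.
have [_ E] := g_basis.
have : joint_ker T w (g j).
  rewrite E; apply/lin_span_rangeP; exists (fun k => (k == j)%:R).
  rewrite (bigD1 j)//= eqxx scale1r big1 ?addr0// => k /negPf ->.
  by rewrite scale0r.
exact.
Qed.

Lemma ker_span v : joint_ker T w v -> exists c, v = \sum_k c k *: g k.
Proof. by have [_ ->] := g_basis => /lin_span_rangeP. Qed.

Definition orth_deriv (s : 'I_N) : H :=
  dg (s1 s) (s2 s) - \sum_c dot (dg (s1 s) (s2 s)) (g c) *: g c.

Lemma orth_deriv_shift l s : shift_op T w l (orth_deriv s) = (s1 s == l)%:R *: g (s2 s).
Proof.
rewrite /orth_deriv shift_op_add shift_op_opp shift_op_sum dg_shift big1 ?subr0// => c _.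
by rewrite g_ker scaler0.
Qed.

Lemma orth_deriv_orth s c : dot (orth_deriv s) (g c) = 0.
Proof.
rewrite /orth_deriv (dotBl dot) dot_suml (bigD1 c)//= (dotZl dot) g_orth eqxx mulr1.
rewrite big1 ?addr0 ?subrr// => k kc.
by rewrite (dotZl dot) g_orth (negPf kc) mulr0.
Qed.

Lemma dot_orth_deriv s t : dot (orth_deriv t) (orth_deriv s) =
  dot (dg (s1 t) (s2 t)) (dg (s1 s) (s2 s)) -
  \sum_c dot (g c) (dg (s1 s) (s2 s)) * dot (dg (s1 t) (s2 t)) (g c).
Proof.
rewrite {2}/orth_deriv (dotBr dot) dot_sumr [X in _ - X]big1 ?subr0; last first.
  by move=> c _; rewrite (dotZr dot) orth_deriv_orth mulr0.
rewrite /orth_deriv (dotBl dot) dot_suml; congr (_ - _); apply: eq_bigr => c _.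
by rewrite (dotZl dot) mulrC.
Qed.

Lemma rank_eq s l k : (s1 s == l) && (s2 s == k) = (s == rk l k).
Proof.
apply/andP/eqP => [[/eqP <- /eqP <-]|->]; first by rewrite tagnat.sig2K.
split; first by rewrite tagnat.Rank1K.
by apply/eqP/val_inj; rewrite /= tagnat.Rank2K.
Qed.

Lemma shift_orth_deriv_sum l (c : 'I_N -> R[i]) :
  shift_op T w l (\sum_s c s *: orth_deriv s) = \sum_k c (rk l k) *: g k.
Proof.
rewrite shift_op_sum.
rewrite (eq_bigr (fun s : 'I_N => (s1 s == l)%:R *: (c s *: g (s2 s)))); last first.
  by move=> s _; rewrite orth_deriv_shift !scalerA mulrC.
rewrite (bigID (fun s : 'I_N => s1 s == l))/= [X in _ + X]big1 ?addr0; last first.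
  by move=> s /negPf ->; rewrite scale0r.
rewrite (reindex_onto (fun k => rk l k) (fun s => s2 s))/=; last first.
  by move=> s /eqP <-; rewrite tagnat.sig2K.
apply: eq_big => [k|k _]; have := rank_eq (rk l k) l k; rewrite eqxx.
  by [].
by move=> /andP[/eqP -> /eqP ->]; rewrite eqxx scale1r.
Qed.

Lemma orth_deriv_free (c : 'I_N -> R[i]) : \sum_s c s *: orth_deriv s = 0 -> forall s, c s = 0.
Proof.
move=> c0 s; have := shift_orth_deriv_sum (s1 s) c; rewrite c0 shift_op0 => /esym.
have [g_free _] := g_basis.
by move=> /g_free/(_ (s2 s)); rewrite tagnat.sig2K.
Qed.

Lemma second_ker_decomposition v : second_ker T w v ->
  exists a b, v = \sum_k a k *: g k + \sum_s b s *: orth_deriv s.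
Proof.
move=> vM.
have [c cP] : {c : 'I_m -> 'I_n -> R[i] & forall l,
    shift_op T w l v = \sum_k c l k *: g k}.
  by apply: (@choice _ _ (fun l d => _ = \sum_k d k *: g k)) => l;
    apply: ker_span => i; exact: vM.
pose b s := c (s1 s) (s2 s).
have [a aP] : exists a, v - \sum_s b s *: orth_deriv s = \sum_k a k *: g k.
  apply: ker_span => l.
  rewrite shift_op_add shift_op_opp cP shift_orth_deriv_sum.
  apply/eqP; rewrite subr_eq0; apply/eqP; apply: eq_bigr => k _.
  have := rank_eq (rk l k) l k; rewrite eqxx => /andP[/eqP e1 /eqP e2].
  by rewrite /b e1 e2.
by exists a, b; rewrite -aP subrK.
Qed.

Theorem local_operators_matrix :
  exists (e : 'I_(n + N) -> H) (t : 'I_m -> 'M[R[i]]_(n, N)),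
    [/\ is_orthonormal_basis dot e (second_ker T w),
        forall l, is_matrix_of e (shift_op T w l) (block_mx 0 (t l) 0 0) &
        let tw := \mxcol_(l < m) t l : 'M[R[i]]_N in
        (tw *m (map_mx Num.conj tw)^T) *m
          (\matrix_(s, t) dot (orth_deriv t) (orth_deriv s)) = 1%:M].
Proof.
have [A Au AG] := gram_factorization dot_norm orth_deriv_free.
pose B := invmx A.
have Bu : B \in unitmx by rewrite unitmx_inv.
pose f b := \sum_s B s b *: orth_deriv s.
pose e (q : 'I_(n + N)) := match fintype.split q with inl k => g k | inr b => f b end.
have el k : e (lshift N k) = g k by rewrite /e (unsplitK (inl k)).
have er b : e (rshift n b) = f b by rewrite /e (unsplitK (inr b)).
pose t l : 'M[R[i]]_(n, N) := \matrix_(k, b) B (rk l k) b.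
have fg b k : dot (f b) (g k) = 0.
  by rewrite dot_suml big1// => s _; rewrite (dotZl dot) orth_deriv_orth mulr0.
have ff b c : dot (f b) (f c) = (b == c)%:R.
  have : (map_mx Num.conj B)^T *m ((map_mx Num.conj A)^T *m A) *m B = 1%:M.
    rewrite !mulmxA -trmx_mul -map_mxM mulmxV// map_mx1 trmx1 mul1mx.
    by rewrite mulmxV.
  rewrite AG => /matrixP/(_ c b); rewrite [RHS]mxE eq_sym => <-.
  rewrite /f dot_sum2 mxE exchange_big; apply: eq_bigr => s _.
  rewrite mxE mulr_suml; apply: eq_bigr => s' _.
  by rewrite !mxE.
have orth i j : dot (e i) (e j) = (i == j)%:R.
  rewrite -(splitK i) -(splitK j).
  case: (fintype.split i) => a; case: (fintype.split j) => b /=.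
  - by rewrite !el g_orth (inj_eq (@lshift_inj _ _)).
  - by rewrite el er (dotC dot) fg conjC0 eq_lrshift.
  - by rewrite el er fg eq_rlshift.
  - by rewrite !er ff (inj_eq (@rshift_inj _ _)).
have fshift l b : shift_op T w l (f b) = \sum_k t l k b *: g k.
  by rewrite shift_orth_deriv_sum; apply: eq_bigr => k _; rewrite mxE.
have orth_deriv_f s : orth_deriv s = \sum_b A b s *: f b.
  rewrite (eq_bigr (fun b => \sum_s' (B s' b * A b s) *: orth_deriv s')); last first.
    move=> b _; rewrite scaler_sumr; apply: eq_bigr => s' _.
    by rewrite scalerA mulrC.
  rewrite exchange_big/= (eq_bigr (fun s' => (s' == s)%:R *: orth_deriv s')).
    rewrite (bigD1 s)//= eqxx scale1r big1 ?addr0// => s' /negPf ->.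
    by rewrite scale0r.
  move=> s' _; rewrite -scaler_suml; congr (_ *: _).
  by have /matrixP/(_ s' s) := mulVmx Au; rewrite !mxE.
exists e, t; split.
- split=> //; split.
    move=> c c0 i.
    have : dot (\sum_k c k *: e k) (e i) = 0 by rewrite c0 (dot0l dot).
    rewrite dot_suml (bigD1 i)//= (dotZl dot) orth eqxx mulr1 big1 ?addr0//.
    by move=> k /negPf ki; rewrite (dotZl dot) orth ki mulr0.
  apply/seteqP; split=> v.
    move=> /second_ker_decomposition[a [b ->]]; apply/lin_span_rangeP.
    exists (fun q => match fintype.split q with
      | inl k => a k | inr c => \sum_s b s * A c s end).
    rewrite big_split_ord/=; congr (_ + _).
      by apply: eq_bigr => k _; rewrite (unsplitK (inl k)) el.
    rewrite [RHS](eq_bigr (fun c => \sum_s (b s * A c s) *: f c)); last first.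
      by move=> c _; rewrite (unsplitK (inr c)) er scaler_suml.
    rewrite exchange_big/=; apply: eq_bigr => s _.
    rewrite {1}orth_deriv_f scaler_sumr; apply: eq_bigr => c _.
    by rewrite scalerA.
  move=> /lin_span_rangeP[c ->] i j.
  rewrite !shift_op_sum big1// => q _.
  suff -> : shift_op T w i (shift_op T w j (e q)) = 0 by rewrite scaler0.
  rewrite -(splitK q); case: (fintype.split q) => k /=.
    by rewrite el g_ker shift_op0.
  rewrite er fshift shift_op_sum big1// => k' _.
  by rewrite g_ker scaler0.
- move=> l q; rewrite -(splitK q); case: (fintype.split q) => k /=.
    rewrite el g_ker big_split_ord/= !big1 ?addr0// => j _.
      by rewrite block_mxEdl mxE scale0r.
    by rewrite block_mxEul mxE scale0r.
  rewrite er fshift big_split_ord/= [X in _ + X]big1 ?addr0.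
    by apply: eq_bigr => j _; rewrite block_mxEur el.
  by move=> j _; rewrite block_mxEdr mxE scale0r.
- move=> tw; have -> : tw = B.
    by apply/matrixP => s b; rewrite !mxE tagnat.sig2K.
  rewrite -AG !mulmxA -(mulmxA B) -trmx_mul -map_mxM mulmxV// map_mx1 trmx1.
  by rewrite mulmx1 mulVmx.
Qed.

End LocalOperators.

Lemma gram_unitmx (K : numClosedFieldType) (H : normedModType K)
    (dot : {dot H for Num.conj}) (dot_norm : forall v : H, `|v| ^+ 2 = dot v v)
    n (g : 'I_n -> H) :
  (forall c : 'I_n -> K, \sum_i c i *: g i = 0 -> forall i, c i = 0) ->
  \matrix_(i, j) dot (g j) (g i) \in unitmx.
Proof.
move=> g_free; have [A Au <-] := gram_factorization dot_norm g_free.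
by rewrite unitmx_mul Au andbT unitmx_tr map_unitmx.
Qed.

Theorem proposition2p1 (R : realType) (m n : nat)
    (H : completeNormedModType R[i]) (dot : {dot H for Num.conj})
    (dot_norm : forall v : H, `|v| ^+ 2 = dot v v)
    (separable : exists2 S : set H, countable S & dense S)
    (Omega : set 'rV[R[i]]_m)
    (Omega_domain : domain Omega) (Omega_bounded : bounded_set Omega)
    (T : 'I_m -> {linear H -> H})
    (T_bounded : forall k, bounded_near (T k) (nbhs (0 : H)))
    (T_commute : forall i j v, T i (T j v) = T j (T i v))
    (T_Bn : in_cowen_douglas T n (conj_set Omega))
    (w : 'rV[R[i]]_m) (Omega_w : conj_set Omega w)
    (U : set 'rV[R[i]]_m) (U_open : open U) (U_w : U w)
    (U_sub : U `<=` conj_set Omega)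
    (gamma : 'I_n -> 'rV[R[i]]_m -> H)
    (gamma_frame : is_holomorphic_frame T gamma U)
    (gamma_w : gram dot gamma w = 1%:M) :
  exists (e : 'I_(n + \sum_(i < m) n) -> H)
         (t : 'I_m -> 'M[R[i]]_(n, \sum_(i < m) n)),
    [/\ is_orthonormal_basis dot e (second_ker T w),
        forall l, is_matrix_of e (shift_op T w l) (block_mx 0 (t l) 0 0),
        curvature_mx dot gamma w \in unitmx &
        let tw := \mxcol_(l < m) t l : 'M[R[i]]_(\sum_(i < m) n) in
        tw *m (map_mx Num.conj tw)^T = - invmx (curvature_mx dot gamma w)].
Proof.
have [gamma_diff gamma_basis] := gamma_frame.
have T_cont k : continuous (T k) by apply/linear_bounded_continuous; exact: T_bounded.
have g_orth i j : dot (gamma i w) (gamma j w) = (i == j)%:R.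
  by move/matrixP : gamma_w => /(_ j i); rewrite !mxE eq_sym.
have gamma_ker j z : U z -> joint_ker T z (gamma j z).
  move=> Uz; have [_ ->] := gamma_basis z Uz; apply/lin_span_rangeP.
  exists (fun k => (k == j)%:R); rewrite (bigD1 j)//= eqxx scale1r big1 ?addr0//.
  by move=> k /negPf ->; rewrite scale0r.
pose dg k j := 'D_('e_k) (gamma j) w.
have dg_shift k l j : shift_op T w l (dg k j) = (k == l)%:R *: gamma j w.
  exact: (shift_op_derive T_cont U_open U_w (gamma_diff j w U_w) (gamma_ker j)).
have [e [t [He Ht Htw]]] := local_operators_matrix dot_norm (gamma_basis w U_w) g_orth dg_shift.
have KE : curvature_mx dot gamma w = - \matrix_(s, t) dot
    (orth_deriv dot (gamma^~ w) dg t) (orth_deriv dot (gamma^~ w) dg s).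
  apply/matrixP => s s'; rewrite [LHS]mxE.
  rewrite (curvature_coef_orthonormal dot_norm U_open U_w gamma_diff) ?gamma_w//.
    by rewrite !mxE dot_orth_deriv.
  by move=> z Uz; apply: gram_unitmx => //; have [] := gamma_basis z Uz.
have tw1 : let tw := \mxcol_(l < m) t l : 'M[R[i]]_(\sum_(i < m) n) in
    curvature_mx dot gamma w *m - (tw *m (map_mx Num.conj tw)^T) = 1%:M.
  by rewrite /= KE mulNmx mulmxN opprK; exact: mulmx1C.
have [Ku _] := mulmx1_unit tw1.
exists e, t; split=> //.
rewrite /= -[LHS]opprK; congr (- _).
by rewrite -[LHS](mulKmx Ku) tw1 mulmx1.
Qed.
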